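(* Let $m,\nu,\mu,\lambda\in\mathbb{R}$ with $(\nu,\mu)\neq(0,0)$, $k\in\mathbb{Z}\setminus\{0\}$, and assume $(k+\lambda)^2+\mu^2-\nu^2=0$. Let $(t(\theta))_{\theta\in[0,\pi)}$ be the one (real) parameter family of self-adjoint extensions of $h$ defined in the context. For $\theta\in[0,\pi)$ the following are equivalent: (i) for any $(f^+,f^-)\in\mathcal{D}(t(\theta))$, setting $$\varphi^-:=\begin{cases}(\nu+\mu)f^++(k+\lambda)f^- & \text{if }\nu+\mu\neq0,\\ -2\nu f^- & \text{if }\nu+\mu=0,\end{cases}$$ we have $\varphi^-\in\mathcal{J}$, where $$\mathcal{J}=\left\{u\in AC[0,M]\text{ for any }M>0:\ \tfrac{u}{r},\,u'\in L^2(0,+\infty)\right\};$$ (ii) $\theta=\begin{cases}\operatorname{arccot}\left(\dfrac{k+\lambda}{\nu+\mu}\right) & \text{if }\nu+\mu\neq0,\\ 0 & \text{if }\nu+\mu=0.\end{cases}$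
   Context: All operators act in $L^2(0,+\infty)^2=L^2((0,+\infty);\mathbb{C}^2)$; $\mathcal{D}(\cdot)$ denotes the domain. $AC[0,M]$ is the space of (complex-valued) absolutely continuous functions on $[0,M]$. $\operatorname{arccot}$ takes values in $(0,\pi)$. The integer $k$ is the index $k=k_j=\pm(j+1/2)$, $j\in\{1/2,3/2,\dots\}$, of a partial wave subspace (the paper writes $h_{m_j,k_j}$, $t(\theta)_{m_j,k_j}$, $f^\pm_{m_j,k_j}$, etc.). Minimal operator: $\mathcal{D}(h)=C_c^\infty(0,+\infty)^2$, and $$h\begin{pmatrix} f^+\\ f^-\end{pmatrix}=\begin{pmatrix} m+\frac{\nu+\mu}{r} & -\partial_r+\frac{k+\lambda}{r}\\ \partial_r+\frac{k+\lambda}{r} & -m+\frac{\nu-\mu}{r}\end{pmatrix}\begin{pmatrix} f^+\\ f^-\end{pmatrix}.$$ Maximal operator: $h^*$ is given by the same expression in the sense of distributions on $(0,+\infty)$, with $\mathcal{D}(h^* )=\{(f^+,f^-)\in L^2(0,+\infty)^2 : h^*(f^+,f^-)\in L^2(0,+\infty)^2\}$; it is the adjoint of $h$. Elements of $\mathcal{D}(h^* )$ are identified with their continuous representatives on $(0,+\infty)$. The family $t(\theta)$, $\theta\in[0,\pi)$: $t(\theta)$ is the restriction of $h^*$ to the set $\mathcal{D}(t(\theta))$ of all $(f^+,f^-)\in\mathcal{D}(h^* )$ for which there exists $(A^+,A^-)\in\mathbb{C}^2$ with $$A^+\sin\theta+A^-\cos\theta=0,\qquad \lim_{r\to0}\left|\begin{pmatrix}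 f^+(r)\\ f^-(r)\end{pmatrix}-(M\log r+\mathbb{I}_2)\begin{pmatrix} A^+\\ A^-\end{pmatrix}\right|r^{-1/2}=0,$$ where $M:=\begin{pmatrix}-(k+\lambda) & -\nu+\mu\\ \nu+\mu & k+\lambda\end{pmatrix}$ and $\mathbb{I}_2$ is the $2\times2$ identity. These are self-adjoint extensions of $h$. *)

(* Defs.v *)
From mathcomp Require Export all_boot all_order all_algebra.
From mathcomp Require Export complex.
From mathcomp Require Export all_classical all_reals all_analysis.

Set Implicit Arguments.
Unset Strict Implicit.
Unset Printing Implicit Defensive.

Export Order.TTheory GRing.Theory Num.Theory numFieldNormedType.Exports.
Export Normc.

#[global] Open Scope classical_set_scope.
#[global] Open Scope ring_scope.
#[global] Open Scope complex_scope.

(* Functions on (0,+oo) are encoded by total functions R -> R[i]; every notion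
   below reads only their values on (0,+oo), except that test functions vanish
   off (0,+oo) and that AC[0,M] also uses the value at 0 (see [Jspace]).
   Measurability, continuity, derivatives and integrals are taken on the real
   and imaginary parts. *)

Definition halfline (R : realType) : set R := [set r | 0 < r].

Definition cintegral (R : realType) (f : R -> R[i]) : R[i] :=
  Rintegral lebesgue_measure (@halfline R) (fun r => complex.Re (f r)) +i*
  Rintegral lebesgue_measure (@halfline R) (fun r => complex.Im (f r)).

Definition L2 (R : realType) : set (R -> R[i]) :=
  [set f : R -> R[i] | [/\ measurable_fun (@halfline R) (fun r => complex.Re (f r)),
               measurable_fun (@halfline R) (fun r => complex.Im (f r)) &
               (\int[lebesgue_measure]_(r in @halfline R)
                  (normc (f r) ^+ 2)%:E < +oo)%E]].

Definition ccontinuous_at (R : realType) (f : R -> R[i]) (r : R) : Prop :=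
  {for r, continuous (fun s => complex.Re (f s))} /\
  {for r, continuous (fun s => complex.Im (f s))}.

Definition is_cderive (R : realType) (f : R -> R[i]) (r : R) (d : R[i]) : Prop :=
  is_derive r 1 (fun s => complex.Re (f s)) (complex.Re d) /\
  is_derive r 1 (fun s => complex.Im (f s)) (complex.Im d).

Definition cderive (R : realType) (f : R -> R[i]) (r : R) : R[i] :=
  derive1 (fun s => complex.Re (f s)) r +i* derive1 (fun s => complex.Im (f s)) r.

Definition csmooth (R : realType) (f : R -> R[i]) : Prop :=
  forall (n : nat) (r : R),
    derivable (derive1n n (fun s => complex.Re (f s))) r 1 /\
    derivable (derive1n n (fun s => complex.Im (f s))) r 1.

(* C_c^oo(0,+oo), each function being extended by 0 to R *)
Definition test_function (R : realType) : set (R -> R[i]) :=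
  [set phi : R -> R[i] | [/\ csmooth phi,
                 compact (closure [set r | phi r != 0]) &
                 closure [set r | phi r != 0] `<=` @halfline R]].

Definition dpairing (R : realType) (u phi : R -> R[i]) : R[i] :=
  cintegral (fun r => u r * phi r).

Definition dpairing_deriv (R : realType) (u phi : R -> R[i]) : R[i] :=
  - dpairing u (cderive phi).

(* Graph of the maximal operator: [hstar_graph m nu mu lam k f g] means that
   f = (f.1, f.2) = (f^+, f^-) is (the continuous representative of) an element
   of D(h^* ) and that h^* f = g as distributions. *)
Definition hstar_graph (R : realType) (m nu mu lam : R) (k : int)
    (f g : (R -> R[i]) * (R -> R[i])) : Prop :=
  [/\ (forall r : R, 0 < r -> ccontinuous_at f.1 r /\ ccontinuous_at f.2 r),
      L2 f.1 /\ L2 f.2,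
      L2 g.1 /\ L2 g.2 &
      forall phi : R -> R[i], test_function phi ->
        dpairing (fun r => (m + (nu + mu) / r)%:C * f.1 r) phi
          + (- dpairing_deriv f.2 phi
             + dpairing (fun r => ((k%:~R + lam) / r)%:C * f.2 r) phi)
          = dpairing g.1 phi
        /\
        (dpairing_deriv f.1 phi
             + dpairing (fun r => ((k%:~R + lam) / r)%:C * f.1 r) phi)
          + dpairing (fun r => (- m + (nu - mu) / r)%:C * f.2 r) phi
          = dpairing g.2 phi].

Definition col2 (T : Type) (x y : T) : 'cV[T]_2 :=
  \col_i (if i == ord0 then x else y).

Definition mx22 (T : Type) (a b c d : T) : 'M[T]_2 :=
  \matrix_(i, j) (if i == ord0 then (if j == ord0 then a else b)
                  else (if j == ord0 then c else d)).

Definition norm_C2 (R : realType) (v : 'cV[R[i]]_2) : R :=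
  Num.sqrt (\sum_(i < 2) normc (v i ord0) ^+ 2).

Definition Mmx (R : realType) (nu mu lam : R) (k : int) : 'M[R[i]]_2 :=
  mx22 (- (k%:~R + lam))%:C (- nu + mu)%:C
       (nu + mu)%:C         (k%:~R + lam)%:C.

Definition boundary_cond (R : realType) (nu mu lam : R) (k : int) (theta : R)
    (f : (R -> R[i]) * (R -> R[i])) : Prop :=
  exists Ap Am : R[i],
    Ap * (sin theta)%:C + Am * (cos theta)%:C = 0 /\
    norm_C2 (col2 (f.1 r) (f.2 r)
             - ((ln r)%:C *: Mmx nu mu lam k + 1%:M) *m col2 Ap Am)
      * r `^ (- 2^-1) @[r --> 0^'+] --> (0 : R).

(* Graph of t(theta), the restriction of h^* *)
Definition t_graph (R : realType) (m nu mu lam : R) (k : int) (theta : R)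
    (f g : (R -> R[i]) * (R -> R[i])) : Prop :=
  hstar_graph m nu mu lam k f g /\ boundary_cond nu mu lam k theta f.

Definition t_domain (R : realType) (m nu mu lam : R) (k : int) (theta : R) :
    set ((R -> R[i]) * (R -> R[i])) :=
  [set f | exists g, t_graph m nu mu lam k theta f g].

(* AC[a,b] for complex-valued functions *)
Definition abs_continuous (R : realType) (a b : R) (v : R -> R[i]) : Prop :=
  forall eps : R, 0 < eps -> exists2 delta : R, 0 < delta &
    forall (n : nat) (x y : 'I_n -> R),
      (forall i, a <= x i /\ x i <= y i /\ y i <= b) ->
      trivIset [set: 'I_n] (fun i => [set t | x i < t < y i]) ->
      \sum_(i < n) (y i - x i) < delta ->
      \sum_(i < n) normc (v (y i) - v (x i)) < eps.

(* u is a function on (0,+oo); u in AC[0,M] means that u has an extension v to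
   [0,+oo) that is absolutely continuous on [0,M]. The derivative u' of such a
   function exists almost everywhere. *)
Definition Jspace (R : realType) : set (R -> R[i]) :=
  [set u : R -> R[i] | [/\ exists v : R -> R[i],
                 (forall r, 0 < r -> v r = u r) /\
                 (forall M, 0 < M -> abs_continuous 0 M v),
               L2 (fun r => u r / r%:C) &
               exists2 u' : R -> R[i], L2 u' &
                 {ae lebesgue_measure, forall r : R,
                    0 < r -> is_cderive u r (u' r)}]].

Definition phi_minus (R : realType) (nu mu lam : R) (k : int)
    (f : (R -> R[i]) * (R -> R[i])) : R -> R[i] :=
  fun r => if nu + mu != 0
           then (nu + mu)%:C * f.1 r + (k%:~R + lam)%:C * f.2 r
           else (- 2 * nu)%:C * f.2 r.

(* the branch of arccot with values in (0, pi) *)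
Definition arccot (R : realType) (x : R) : R := pi / 2 - atan x.

(* Main.v *)
Require Import Defs.
From mathcomp Require Import ring lra measurable_realfun.

(** Put kap = k + lam, let M be the matrix of the boundary condition, and on
    (0, oo) read h^* f = g as f' = M f / r + b with
    b = (g^- + m f^-, m f^+ - g^+), which is in L^2.  The criticality hypothesis
    says exactly that M^2 = 0.

    The function phi^- has the form c f for a row vector c with c M = 0: c is the
    second row (nu + mu, kap) of M if nu + mu <> 0; if nu + mu = 0, then kap = 0
    as well and c = (0, -2 nu) works.  Multiplying the equation by c therefore
    kills its singular part: (c f)' = c b, an L^2 function, although neither f^+
    nor f^- has such a derivative in general.  Also, c (M log r + 1) A = c A, so
    by the boundary condition c f tends to c A at 0.  Hence c f - c A is the
    primitive of an L^2 function.  A primitive that starts from 0 belongs to J, by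
    Hardy's inequality; a nonzero limit at 0 makes u / r fail to be square
    integrable.  So c f is in J exactly when c A = 0.  The boundary condition
    confines A to the line spanned by (cos theta, - sin theta), hence (i) amounts
    to c1 cos theta = c2 sin theta, provided that some f in the domain of
    t(theta) realizes this A.  Such an f is exp(- r) (M log r + 1) A: because
    M^2 = 0 it satisfies f' = M f / r - f, so b = - f is in L^2, and
    c f = (c A) exp(- r).  Solving c1 cos theta = c2 sin theta for theta in
    [0, pi) gives (ii).

    The equation holds in the sense of distributions, and a du Bois-Reymond lemma
    ([weak_derivative_increment]) turns it into increments of the continuous
    representative; smooth bump functions are built for that purpose from
    exp(- 1 / x).  [Jspace_primitive] collects what is needed for J: absolute
    continuity ([primitive_absolutely_continuous]), differentiability almost
    everywhere ([primitive_ae_derive]) and Hardy's inequality ([hardy]).  The two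
    implications are [t_domain_Jspace] and [Jspace_t_domain].  Complex functions
    are treated through their real and imaginary parts, which satisfy the same
    equations because all coefficients are real. *)

Set Implicit Arguments.
Unset Strict Implicit.
Unset Printing Implicit Defensive.

(** * Smooth bump functions *)

Section SmoothBump.
Context {R : realType}.
Implicit Types (f g : R -> R) (p : {poly R}) (x : R).

Lemma is_derive_derive1 f x (d : R) : is_derive x 1 f d -> derive1 f x = d.
Proof. by move=> h; rewrite derive1E derive_val. Qed.

Lemma is_derive_continuous f x (d : R) : is_derive x 1 f d -> {for x, continuous f}.
Proof. by case=> /derivable1_diffP /differentiable_continuous. Qed.

Definition rsmooth f : Prop := forall n x, derivable (derive1n n f) x 1.

(** Iterated derivatives have no closed form for the functions used below, so
    smoothness is obtained from a class of functions stable under derivation. *)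
Lemma rsmooth_coind (P : (R -> R) -> Prop) f :
  (forall g, P g -> (forall x, derivable g x 1) /\ P (derive1 g)) -> P f -> rsmooth f.
Proof.
move=> Pd Pf n; suff : P (derive1n n f) by move/Pd => [].
by elim: n => [//|n /Pd[_]]; rewrite derive1nS.
Qed.

Lemma rsmooth_primitive f g :
  (forall x, is_derive x 1 f (g x)) -> rsmooth g -> rsmooth f.
Proof.
move=> fg sg [|n] x; first by case: (fg x).
suff -> : derive1n n.+1 f = derive1n n g by exact: sg.
by rewrite derive1Sn; congr (derive1n n _); apply/funext => y; exact: is_derive_derive1.
Qed.

(** Each monomial satisfies x^n exp(- x) <= n!, by the exponential series. *)
Lemma poly_expR_bounded p :
  exists2 C : R, 0 <= C & forall x, 0 <= x -> `|p.[x]| * expR (- x) <= C.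
Proof.
have mono n x : 0 <= x -> x ^+ n * expR (- x) <= n`!%:R.
  move=> x0; rewrite expRN ler_pdivrMr ?expR_gt0//.
  case: n => [|n]; first by rewrite expr0 fact0 mul1r -expR0 ler_expR.
  have := expR_ge1Dxn n x0.
  have f0 : (0 : R) < n.+1`!%:R by rewrite ltr0n fact_gt0.
  rewrite -(ler_pM2l f0) => /(le_trans _); apply.
  by rewrite mulrDr mulr1 mulrCA divff ?gt_eqF// mulr1 lerDr ltW.
exists (\sum_(i < size p) `|p`_i| * i`!%:R).
  by apply: sumr_ge0 => i _; rewrite mulr_ge0.
move=> x x0; rewrite horner_coef.
apply: (@le_trans _ _ ((\sum_(i < size p) `|p`_i| * x ^+ i) * expR (- x))).
  rewrite ler_wpM2r ?expR_ge0//; apply: (le_trans (ler_norm_sum _ _ _)).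
  by apply: ler_sum => i _; rewrite normrM (ger0_norm (exprn_ge0 _ x0)).
rewrite mulr_suml; apply: ler_sum => i _.
by rewrite -mulrA ler_wpM2l// mono.
Qed.

(** The derivatives of exp(- 1 / x) are polynomials in 1 / x times exp(- 1 / x);
    allowing every polynomial p makes the family stable under derivation. *)
Definition flat p x : R := if 0 < x then p.[x^-1] * expR (- x^-1) else 0.

(** At the origin the difference quotient is O(z), because t^2 p(t) exp(- t) is
    bounded for t = 1 / z > 0. *)
Lemma flat_derive p x : is_derive x 1 (flat p) (flat ('X^2 * (p - p^`())) x).
Proof.
have [x0|x0|<-] := ltgtP 0 x.
- have xn0 : x != 0 by rewrite gt_eqF.
  pose F y := p.[y^-1] * expR (- y^-1).
  suff : is_derive x 1 F (flat ('X^2 * (p - p^`())) x).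
    apply: near_eq_is_derive; near=> y; rewrite /flat ifT//.
    by near: y; exact: lt_nbhsr.
  have dV : is_derive x 1 (fun y : R => y^-1) (- x ^- 2).
    by apply: (is_derive_eq (is_deriveV (f := id) xn0 _)); rewrite scaler1.
  have d1 : is_derive x 1 (fun y : R => p.[y^-1]) (p^`().[x^-1] * - x ^- 2).
    exact: (is_derive1_comp (is_derive_poly p x^-1) dV).
  have d2 : is_derive x 1 (fun y : R => expR (- y^-1)) (expR (- x^-1) * x ^- 2).
    apply: (is_derive1_comp (g := fun y : R => - y^-1)).
    by apply: is_derive_eq; rewrite opprK.
  apply: is_derive_eq.
  rewrite /flat x0 !hornerE /= /GRing.scale /= -exprVn; ring.
- have -> : flat ('X^2 * (p - p^`())) x = 0 by rewrite /flat ltNge (ltW x0).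
  apply: (near_eq_is_derive (f := cst 0)).
  near=> y; rewrite /flat ltNge ltW//; near: y; exact: lt_nbhsl.
- have [C C0 HC] := poly_expR_bounded ('X^2 * p).
  apply/is_derive1_caratheodory.
  (* Caratheodory's form of the derivative: the slope function, extended by its
     limit 0. *)
  exists (fun z => if z == 0 then 0 else flat p z / z); split.
  + move=> z; rewrite [flat p 0]/flat ltxx !subr0.
    by case: eqP => [->|/eqP z0]; rewrite ?mul0r ?divfK// /flat ltxx.
  + rewrite /prop_for /continuous_at /= eqxx; apply: norm_cvg0.
    apply: (@squeeze_cvgr _ _ _ _ (cst 0) (fun z => C * `|z|)).
    * apply: nearW => z; rewrite normr_ge0 /=.
      have [->|z0] := eqVneq z 0; first by rewrite normr0 mulr0.
      rewrite /flat; case: ltP => [zp|_]; last by rewrite mul0r normr0 mulr_ge0.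
      have zV : 0 <= z^-1 by rewrite invr_ge0 ltW.
      have := HC _ zV; rewrite !hornerE normrM (ger0_norm (exprn_ge0 _ zV)).
      rewrite (gtr0_norm zp) !normrM (gtr0_norm (expR_gt0 _)) (ger0_norm zV).
      set e := expR _; set q := `|p.[_]| => h.
      have -> : q * e * z^-1 = (z^-1 ^+ 2 * q * e) * z.
        by rewrite exprVn; field.
      by rewrite ler_wpM2r// ltW.
    * exact: cvg_cst.
    * have nrm0 : `|z| @[z --> (0 : R)] --> (0 : R).
        by rewrite -[X in _ --> X](@normr0 _ R); apply: cvg_norm; exact: cvg_id.
      by rewrite -[X in _ --> X](mulr0 C); exact: cvgMl_tmp.
  + by rewrite eqxx /flat ltxx.
Unshelve. all: by end_near. Qed.

(** Affine substitutions and ring operations let bumps be placed and rescaled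
    anywhere; by [flat_algebra_derive] the class stays stable under derivation. *)
Inductive flat_algebra : (R -> R) -> Prop :=
| flat_algebra_gen p (a b : R) : flat_algebra (fun x => flat p (a + b * x))
| flat_algebra_add f g : flat_algebra f -> flat_algebra g ->
    flat_algebra (fun x => f x + g x)
| flat_algebra_scale (c : R) f : flat_algebra f -> flat_algebra (fun x => c * f x)
| flat_algebra_mul f g : flat_algebra f -> flat_algebra g ->
    flat_algebra (fun x => f x * g x).

Lemma flat_algebra_derive f : flat_algebra f ->
  exists2 g, flat_algebra g & forall x, is_derive x 1 f (g x).
Proof.
elim=> [p a b|{}f g _ [f' Af' df] _ [g' Ag' dg]|c {}f _ [f' Af' df]
  |{}f g Af [f' Af' df] Ag [g' Ag' dg]].
- exists (fun x => flat (b *: ('X^2 * (p - p^`()))) (a + b * x)).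
    exact: flat_algebra_gen.
  move=> x.
  have d1 : is_derive x 1 (fun y : R => a + b * y) b.
    by apply: is_derive_eq; rewrite add0r mul1r /GRing.scale /= mulr1.
  rewrite (_ : flat _ _ = flat ('X^2 * (p - p^`())) (a + b * x) * b).
    exact: (is_derive1_comp (g := fun y => a + b * y) (flat_derive p _) d1).
  by rewrite /flat; case: ifP => _; rewrite ?mul0r// hornerZ; ring.
- exists (fun x => f' x + g' x); first exact: flat_algebra_add.
  by move=> x; apply: is_deriveD.
- exists (fun x => c * f' x); first exact: flat_algebra_scale.
  by move=> x; apply: is_deriveZ.
- exists (fun x => f x * g' x + g x * f' x).
    by apply: flat_algebra_add; apply: flat_algebra_mul.
  by move=> x; apply: is_deriveM.
Qed.

Lemma flat_algebra_smooth f : flat_algebra f -> rsmooth f.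
Proof.
apply: rsmooth_coind => g /flat_algebra_derive[g' Ag' dg]; split.
  by move=> x; case: (dg x).
by rewrite (_ : derive1 g = g')//; apply/funext => x; exact: is_derive_derive1.
Qed.

Definition bump x : R := flat 1 x * flat 1 (1 - x).

Lemma bump_eq0 x : ~~ (0 < x < 1) -> bump x = 0.
Proof.
rewrite negb_and /bump /flat subr_gt0 => /orP[]/negPf->; first by rewrite mul0r.
by rewrite mulr0.
Qed.

Lemma bump_gt0 x : 0 < x < 1 -> 0 < bump x.
Proof.
move=> /andP[x0 x1]; rewrite /bump /flat subr_gt0 x0 x1 -polyC1 !hornerC !mul1r.
by apply: mulr_gt0; exact: expR_gt0.
Qed.

Lemma bump_ge0 x : 0 <= bump x.
Proof.
by have [/bump_gt0/ltW//|/bump_eq0->] := boolP (0 < x < 1).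
Qed.

Lemma bump_rescaled_algebra (a b : R) : flat_algebra (fun x => bump (a + b * x)).
Proof.
rewrite [X in flat_algebra X](_ : _ = fun x => flat 1 (a + b * x)
   * flat 1 ((1 - a) + (- b) * x)).
  by apply: flat_algebra_mul; exact: flat_algebra_gen.
by apply/funext => x; rewrite /bump; congr (_ * flat _ _); ring.
Qed.

Lemma bump_continuous : continuous bump.
Proof.
have [g _ dg] := flat_algebra_derive (bump_rescaled_algebra 0 1).
move=> x; move: (is_derive_continuous (dg x)).
by under [X in {for _, continuous X}]eq_fun do rewrite add0r mul1r.
Qed.

End SmoothBump.

(** * Integration on the half-line *)

Section HalfLine.
Context {R : realType}.
Local Notation mu := (@lebesgue_measure R).
Local Notation H := (@halfline R).
Implicit Types (f g u : R -> R) (a b c : R).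

Local Notation RM := (measurableTypeR R).
Local Notation integ A f := (mu.-integrable A (EFin \o f)).

Lemma integD (A : set RM) f g : measurable A ->
  integ A f -> integ A g -> integ A (fun r => f r + g r).
Proof. by move=> mA iF iG; have := integrableD mA iF iG. Qed.

Lemma integZ (A : set RM) c f : measurable A ->
  integ A f -> integ A (fun r => c * f r).
Proof. by move=> mA iF; have := integrableZl mA c iF. Qed.

Lemma integ_le (A : set RM) f g : measurable A -> measurable_fun A f ->
  (forall r, A r -> `|f r| <= `|g r|) -> integ A g -> integ A f.
Proof.
move=> mA mf fg; apply: le_integrable => //; exact/measurable_EFinP.
Qed.

Lemma integ_cst (A : set RM) c : measurable A -> (mu A < +oo)%E -> integ A (fun=> c).
Proof.
move=> mA Afin; apply: measurable_bounded_integrable => //.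
exact: bounded_cst.
Qed.

Lemma integ_sub (A B : set RM) f : measurable A -> measurable B -> B `<=` A ->
  integ A f -> integ B f.
Proof. exact: integrableS. Qed.

Lemma mu_itv_fin a b (x y : bool) : (mu [set` Interval (BSide x a) (BSide y b)] < +oo)%E.
Proof. by rewrite lebesgue_measure_itv /=; case: ifP => // _; rewrite -EFinB ltry. Qed.

Lemma halflineE : H = `]0, +oo[%classic.
Proof. by apply/seteqP; split=> r; rewrite /halfline /= in_itv /= andbT. Qed.

Lemma measurable_halfline : measurable (H : set RM).
Proof. by rewrite halflineE. Qed.
Hint Resolve measurable_halfline : core.

Lemma itv_cc_halfline a b : 0 < a -> `[a, b] `<=` H.
Proof. by move=> a0 r /=; rewrite in_itv /= => /andP[/(lt_le_trans a0)]. Qed.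

Lemma itv_oc_halfline a b : 0 <= a -> `]a, b] `<=` H.
Proof. by move=> a0 r /=; rewrite in_itv /= => /andP[/(le_lt_trans a0)]. Qed.

(** Monotone convergence along [1/(n+2), n+2]: on each compact piece the
    fundamental theorem of calculus is available, even when the integrand is
    singular at 0. *)
Lemma exhaustion_integral_le (A : set RM) f (C : \bar R) :
  measurable A -> A `<=` H -> measurable_fun A f -> (forall r, A r -> 0 <= f r) ->
  (forall a b, 0 < a -> a < b -> (\int[mu]_(r in A `&` `[a, b]) (f r)%:E <= C)%E) ->
  (\int[mu]_(r in A) (f r)%:E <= C)%E.
Proof.
move=> mA AH mf f0 fC.
pose F n := A `&` `[n.+2%:R^-1, n.+2%:R]%classic.
have FA : \bigcup_n F n = A.
  apply/seteqP; split=> [r [n _ []]//|r Ar].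
  have r0 : 0 < r := AH _ Ar.
  pose n := Num.truncn (r + r^-1).
  have rV0 : 0 < r^-1 by rewrite invr_gt0.
  have hn : r + r^-1 < n.+1%:R by rewrite truncnS_gt// addr_ge0// ltW.
  have hn2 : (n.+1%:R : R) <= n.+2%:R by rewrite ler_nat.
  exists n => //; split=> //=; rewrite in_itv /=; apply/andP; split.
    rewrite -[leRHS]invrK lef_pV2 ?posrE ?ltr0n//; lra.
  by lra.
have mF i : measurable (F i) by exact: measurableI.
have FsA i : F i `<=` A by move=> r [].
have cvgF : (\int[mu]_(r in F n) (f r)%:E @[n --> \oo] -->
             \int[mu]_(r in \bigcup_n F n) (f r)%:E)%E.
  apply: ge0_nondecreasing_set_cvg_integral => //.
  - move=> n p np; apply/subsetPset => r [Ar /=]; rewrite in_itv /= => /andP[nr rn].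
    split=> //=; rewrite in_itv /=; apply/andP; split.
      by apply: le_trans nr; rewrite lef_pV2 ?posrE ?ltr0n// ler_nat !ltnS.
    by apply: (le_trans rn); rewrite ler_nat !ltnS.
  - by move=> i; apply/measurable_EFinP; exact: measurable_funS mf.
  - by move=> i r /FsA /f0; rewrite lee_fin.
rewrite -[in leLHS]FA -(cvg_lim _ cvgF)//; apply: lime_le.
  exact: (cvgP _ cvgF).
apply: nearW => n; apply: fC; first by rewrite invr_gt0.
by rewrite (@lt_trans _ _ 1)// ?ltr1n// invf_lt1// ltr1n.
Qed.

(** This is [L2] for real functions; see [L2P]. *)
Definition sqint f : Prop :=
  measurable_fun H f /\ (\int[mu]_(r in H) (f r ^+ 2)%:E < +oo)%E.

Lemma sqint_integrable f : sqint f -> mu.-integrable H (EFin \o (fun r => f r ^+ 2)).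
Proof.
move=> [mf fi]; apply/integrableP; split.
  by apply/measurable_EFinP; exact: measurable_funX.
apply: le_lt_trans fi; apply: ge0_le_integral => //=.
- by do 2 apply: measurableT_comp => //; exact: measurable_funX.
- by apply: measurableT_comp => //; exact: measurable_funX.
- by move=> r _; rewrite lee_fin ger0_norm ?sqr_ge0.
Qed.

Lemma sqintP f : measurable_fun H f ->
  mu.-integrable H (EFin \o (fun r => f r ^+ 2)) -> sqint f.
Proof.
move=> mf /integrableP[_ fi]; split=> //; apply: le_lt_trans fi.
apply: ge0_le_integral => //=.
- by move=> r _; rewrite lee_fin sqr_ge0.
- by apply: measurableT_comp => //; exact: measurable_funX.
- by do 2 apply: measurableT_comp => //; exact: measurable_funX.
- by move=> r _; rewrite lee_fin ler_norm.
Qed.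

Lemma sqint_le f g : measurable_fun H f -> sqint g ->
  (forall r, 0 < r -> `|f r| <= `|g r|) -> sqint f.
Proof.
move=> mf sg fg; apply: sqintP => //.
apply: (le_integrable _ _ _ (sqint_integrable sg)) => //=.
  by apply/measurable_EFinP; exact: measurable_funX.
by move=> r r0; rewrite lee_fin !normrX ler_pXn2r ?nnegrE// fg.
Qed.

Lemma sqintZ c f : sqint f -> sqint (fun r => c * f r).
Proof.
move=> sf; apply: sqintP; first by apply: measurable_funM => //; case: sf.
rewrite (_ : (fun r => _ ^+ 2) = fun r => c ^+ 2 * f r ^+ 2).
  by apply: integZ => //; exact: sqint_integrable.
by apply/funext => r; rewrite exprMn.
Qed.

Lemma sqintD f g : sqint f -> sqint g -> sqint (fun r => f r + g r).
Proof.
move=> sf sg.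
have mfg : measurable_fun H (fun r => f r + g r).
  by apply: measurable_funD; [case: sf|case: sg].
apply: sqintP => //.
apply: integ_le (integD _ (sqint_integrable (sqintZ 2 sf))
  (sqint_integrable (sqintZ 2 sg))) => //; first exact: measurable_funX.
move=> r _; rewrite ger0_norm ?sqr_ge0// ger0_norm ?addr_ge0 ?sqr_ge0//.
have := sqr_ge0 (f r - g r); have := sqr_ge0 (f r); have := sqr_ge0 (g r).
by rewrite !expr2; nra.
Qed.

(** The bound is |f| <= 1 + f^2. *)
Lemma sqint_integrable_finite (A : set RM) f : measurable A -> A `<=` H ->
  (mu A < +oo)%E -> sqint f -> integ A f.
Proof.
move=> mA AH muA sf.
have i2 : integ A (fun r => f r ^+ 2).
  by apply: integ_sub (sqint_integrable sf).
apply: integ_le (integD mA (integ_cst 1 mA muA) i2) => //.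
  by apply: measurable_funS (sf.1).
move=> r _; rewrite (ger0_norm (addr_ge0 _ _)) ?sqr_ge0//.
have := sqr_ge0 (`|f r| - 1); have := sqr_ge0 (`|f r|).
by rewrite -(real_normK (num_real (f r))) !expr2; nra.
Qed.

(** Local integrability on the open half-line, the class in which all pairings
    with test functions make sense; it contains both the L^2 functions and their
    products with 1 / r. *)
Definition locint f : Prop := forall a b, 0 < a -> integ `[a, b] f.

Lemma sqint_locint f : sqint f -> locint f.
Proof.
move=> sf a b a0; apply: sqint_integrable_finite => //.
  exact: itv_cc_halfline.
exact: mu_itv_fin.
Qed.

Lemma continuous_locint f :
  (forall r, 0 < r -> {for r, continuous f}) -> locint f.
Proof.
move=> cf a b a0; apply: continuous_compact_integrable.
  exact: segment_compact.
apply: continuous_in_subspaceT => r; rewrite inE => /(itv_cc_halfline a0).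
exact: cf.
Qed.

Lemma locintD f g : locint f -> locint g -> locint (fun r => f r + g r).
Proof. by move=> lf lg a b a0; apply: integD; [|exact: lf|exact: lg]. Qed.

Lemma locintZ c f : locint f -> locint (fun r => c * f r).
Proof. by move=> lf a b a0; apply: integZ; [|exact: lf]. Qed.

Lemma locintM f g : (forall r, 0 < r -> {for r, continuous f}) -> locint g ->
  locint (fun r => f r * g r).
Proof.
move=> cf lg a b a0.
have cab : {within `[a, b], continuous f}.
  apply: continuous_in_subspaceT => r; rewrite inE => /(itv_cc_halfline a0).
  exact: cf.
have mab : measurable (`[a, b]%classic : set RM) by [].
have mf : measurable_fun (`[a, b]%classic : set RM) f.
  exact: subspace_continuous_measurable_fun.
have bf : [bounded f r | r in `[a, b]%classic].
  have /compact_bounded[M [_ mrt]] := continuous_compact cab (@segment_compact R a b).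
  by exists M; split; rewrite ?num_real // => ? ? ? ?; exact: mrt.
exact: (integrableMr mab mf bf (lg a b a0)).
Qed.

Lemma patch_support f a b : 0 < a -> (forall r, r \notin `[a, b] -> f r = 0) ->
  f \_ H = f \_ `[a, b].
Proof.
move=> a0 fab; apply/funext => r; rewrite !patchE.
have [/= rab|/= rab] := boolP (r \in `[a, b]%classic).
  by rewrite mem_set//; move: rab; rewrite inE; exact: itv_cc_halfline.
rewrite fab; first by case: ifP.
by apply: contra rab => rab; rewrite inE.
Qed.

(** Integrals against test functions only see a compact interval away from the
    singular point 0. *)
Lemma Rintegral_support f a b : 0 < a -> (forall r, r \notin `[a, b] -> f r = 0) ->
  \int[mu]_(r in H) f r = \int[mu]_(r in `[a, b]) f r.
Proof.
by move=> a0 fab; rewrite Rintegral_mkcond (patch_support a0 fab) -Rintegral_mkcond.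
Qed.

Lemma integ_support f a b : 0 < a -> (forall r, r \notin `[a, b] -> f r = 0) ->
  integ `[a, b] f -> integ H f.
Proof.
move=> a0 fab /integrable_mkcond => /(_ _); rewrite restrict_EFin => iab.
apply/integrable_mkcond => //; rewrite restrict_EFin (patch_support a0 fab).
exact: iab.
Qed.

(** Two-sided derivatives at the end points spare the one-sided limits there. *)
Lemma integral_is_derive F f a b : a < b ->
  (forall r, a <= r <= b -> is_derive r 1 F (f r)) ->
  (forall r, a <= r <= b -> {for r, continuous f}) ->
  (\int[mu]_(r in `[a, b]) (f r)%:E = (F b - F a)%:E)%E.
Proof.
move=> ab dF cf; rewrite EFinB; apply: continuous_FTC2 => //.
- apply: continuous_in_subspaceT => r; rewrite inE /= in_itv /=; exact: cf.
- have cF r : a <= r <= b -> {for r, continuous F}.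
    by move=> /dF; exact: is_derive_continuous.
  split.
  + move=> r; rewrite in_itv /= => /andP[ar rb].
    by case: (dF r _) => //; rewrite !ltW.
  + by apply: cvg_at_right_filter; apply: cF; rewrite lexx ltW.
  + by apply: cvg_at_left_filter; apply: cF; rewrite lexx ltW.
- move=> r; rewrite in_itv /= => /andP[ar rb].
  by apply: is_derive_derive1; apply: dF; rewrite !ltW.
Qed.

Lemma Rintegral_is_derive F f a b : a < b ->
  (forall r, a <= r <= b -> is_derive r 1 F (f r)) ->
  (forall r, a <= r <= b -> {for r, continuous f}) ->
  \int[mu]_(r in `[a, b]) f r = F b - F a.
Proof. by move=> ab dF cf; rewrite /Rintegral (integral_is_derive ab dF cf). Qed.

End HalfLine.

(** * The du Bois-Reymond lemma *)

Section DuBoisReymond.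
Context {R : realType}.
Local Notation mu := (@lebesgue_measure R).
Local Notation H := (@halfline R).
Local Notation RM := (measurableTypeR R).
Local Notation integ A f := (mu.-integrable A (EFin \o f)).
Implicit Types (f g u s rho : R -> R) (a b c t r : R).

(** The step s is the normalized primitive of a bump.  The differences of rescaled
    steps are the test functions of [weak_derivative_increment]. *)
Lemma smooth_step : exists (s : R -> R) (rho : R -> R),
  [/\ forall t, is_derive t 1 s (rho t),
      forall a b, flat_algebra (fun t => rho (a + b * t)),
      forall t, 0 <= rho t,
      (forall t, t <= 0 -> s t = 0) /\ (forall t, 1 <= t -> s t = 1) &
      (forall t, 0 <= s t <= 1) /\ (forall t, ~~ (0 < t < 1) -> rho t = 0)].
Proof.
(* Integrating from -oo makes F differentiable at every point, including the
   points to the left of the support. *)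
pose F t := \int[mu]_(r in `]-oo, t]) (@bump R) r.
have ib : mu.-integrable setT (EFin \o (@bump R)).
  have ib01 : integ `[0, 1] (@bump R).
    apply: continuous_compact_integrable; first exact: segment_compact.
    by apply: continuous_subspaceT => r; exact: bump_continuous.
  have m01 : measurable (`[0, 1]%classic : set RM) by [].
  move/(integrable_mkcond _ m01) : ib01; rewrite restrict_EFin.
  congr (_.-integrable _ _); apply/funext => r; rewrite /= patchE.
  case: ifPn => //; rewrite notin_setE /= in_itv /= => r01.
  by rewrite bump_eq0//; apply: contra_notN r01 => /andP[? ?]; rewrite !ltW.
have ibt t : integ `]-oo, t] (@bump R) by apply: integ_sub ib.
have dF t : is_derive t 1 F (bump t).
  have tt1 : t < t + 1 by rewrite ltrDl.
  have [dF F'] := continuous_FTC1 tt1 (ibt _) (ltNyr _) (@bump_continuous R t).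
  by rewrite -F' derive1E; exact: derivableP.
have F0 t : t <= 0 -> F t = 0.
  move=> t0; rewrite /F (@eq_Rintegral _ _ _ _ _ (cst 0)); last first.
    move=> r; rewrite inE /= in_itv /= => rt; apply: bump_eq0.
    by rewrite negb_and -leNgt (le_trans rt t0).
  by rewrite Rintegral_cst// mul0r.
have F1 t : 1 <= t -> F t = F 1.
  move=> t1; rewrite /F Rintegral_mkcond [RHS]Rintegral_mkcond.
  congr (Rintegral _ _ _); apply/funext => r; rewrite !patchE.
  case: (leP r 1) => r1.
    by rewrite !mem_set//= in_itv//= (le_trans r1 t1).
  by rewrite bump_eq0; [do 2 case: ifP|rewrite (ltNge _ 1) (ltW r1) andbF].
have F1_gt0 : 0 < F 1.
  have [c c01] := @MVT R F bump 0 1 ltr01 (fun x _ => dF x)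
    (continuous_subspaceT (fun x => is_derive_continuous (dF x))).
  rewrite (F0 0)// !subr0 mulr1 => ->; apply: bump_gt0.
  by move: c01; rewrite in_itv.
have Fnd t t' : t <= t' -> F t <= F t'.
  move=> tt'; rewrite -subr_ge0.
  have [c _ ->] := @MVT_segment R F bump t t' tt' (fun x _ => dF x)
    (continuous_subspaceT (fun x => is_derive_continuous (dF x))).
  by rewrite mulr_ge0 ?bump_ge0// subr_ge0.
have F1n0 : F 1 != 0 by rewrite gt_eqF.
exists (fun t => (F 1)^-1 * F t), (fun t => (F 1)^-1 * bump t); split.
- by move=> t; apply: is_deriveZ.
- by move=> a b; apply: flat_algebra_scale; exact: bump_rescaled_algebra.
- by move=> t; rewrite mulr_ge0 ?bump_ge0// invr_ge0 ltW.
- by split=> t t01; [rewrite (F0 t)// mulr0|rewrite (F1 t)// mulVf].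
- split=> [t|t t01]; last by rewrite bump_eq0// mulr0.
  rewrite mulr_ge0 ?invr_ge0 ?(ltW F1_gt0)//=; last first.
    have [t0|/ltW t0] := leP t 0; first by rewrite (F0 t).
    by rewrite -(F0 0)// Fnd.
  rewrite ler_pdivrMl// mulr1.
  have [t1|/ltW t1] := leP t 1; first exact: Fnd.
  by rewrite (F1 t).
Qed.

(** The rescaled bumps have integral 1 and are supported in [x, x + 1/(n+1)], where
    u is close to u x. *)
Lemma approximate_identity (rho u : R -> R) (x : R) : 0 < x ->
  (forall r, 0 < r -> {for r, continuous u}) ->
  (forall t, 0 <= rho t) -> (forall t, ~~ (0 < t < 1) -> rho t = 0) ->
  continuous rho -> (exists2 s, forall t : R, is_derive t 1 s (rho t) & s 1 - s 0 = 1) ->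
  \int[mu]_(r in H) (u r * (n.+1%:R * rho (n.+1%:R * (r - x)))) @[n --> \oo] --> u x.
Proof.
move=> x0 cu rho_ge0 rho_eq0 crho [s ds s1].
apply/cvgrPdist_le => e e0.
have /cvgrPdist_le/(_ e e0) ux := cu x x0.
have [d /= d0 Hd] := ux.
near=> n.
set N : R := n.+1%:R; pose b := x + N^-1.
have N0 : 0 < N by rewrite ltr0n.
have xb : x < b by rewrite ltrDl invr_gt0.
pose psi r := N * rho (N * (r - x)).
have dpsi r : is_derive r 1 (fun t => s (N * (t - x))) (psi r).
  have d1 : is_derive r 1 (fun t => N * (t - x)) N.
    by apply: is_derive_eq; rewrite subr0 /GRing.scale /= mulr1.
  rewrite /psi mulrC.
  exact: (is_derive1_comp (g := fun t => N * (t - x)) (ds _) d1).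
have cpsi : continuous psi.
  move=> r; apply: cvgMl_tmp; apply: (@continuous_comp _ _ _ (fun t => N * (t - x)) rho).
    by apply: cvgMl_tmp; apply: cvgB; [exact: cvg_id|exact: cvg_cst].
  exact: crho.
have psi_ge0 r : 0 <= psi r by rewrite mulr_ge0// ltW.
have psi_out r : r \notin `[x, b] -> psi r = 0.
  rewrite in_itv /= negb_and -!ltNge /psi => /orP[rx|br].
    by rewrite rho_eq0 ?mulr0// negb_and -leNgt pmulr_rle0// subr_le0 ltW.
  rewrite rho_eq0 ?mulr0// negb_and -!leNgt orbC -ler_pdivrMl// mulr1.
  by rewrite lerBrDl ltW.
have psi1 : \int[mu]_(r in `[x, b]) psi r = 1.
  rewrite (Rintegral_is_derive xb (fun r _ => dpsi r) (fun r _ => @cpsi r)).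
  by rewrite subrr mulr0 /b addrAC subrr add0r divff// gt_eqF.
have upsi_out r : r \notin `[x, b] -> u r * psi r = 0.
  by move=> /psi_out ->; rewrite mulr0.
rewrite (Rintegral_support x0 upsi_out).
have mab : measurable (`[x, b]%classic : set RM) by [].
have lpsi : locint psi by apply: continuous_locint => r _; exact: cpsi.
have ipsi : integ `[x, b] psi by exact: lpsi.
have iu : integ `[x, b] (fun r => u r * psi r).
  exact: locintM.
have -> : u x = \int[mu]_(r in `[x, b]) (u x * psi r).
  by rewrite RintegralZl// psi1 mulr1.
have iux : integ `[x, b] (fun r => u x * psi r) by exact: integZ.
rewrite -RintegralB//.
have idiff : integ `[x, b] (fun r => u x * psi r - u r * psi r).
  have := integD mab iux (integZ (-1) mab iu).
  by congr (_.-integrable _ _); apply/funext => r /=; rewrite mulN1r.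
apply: (le_trans (le_normr_Rintegral _ _)) => //.
rewrite -[leRHS]mulr1 -psi1 -RintegralZl//; apply: le_Rintegral => //.
- by apply: integrable_norm.
- exact: integZ.
move=> r; rewrite /= in_itv /= => /andP[xr rb].
rewrite -mulrBl normrM (ger0_norm (psi_ge0 r)) ler_wpM2r//.
apply: Hd => /=; rewrite distrC ger0_norm ?subr_ge0//.
apply: le_lt_trans (_ : N^-1 < d); first by rewrite lerBlDl.
by rewrite /N; near: n; exact: (near_infty_natSinv_lt (PosNum d0)).
Unshelve. all: by end_near. Qed.

(** Test functions are given by a smooth real function and an interval that
    contains its support. *)
Definition weak_derivative u (beta : R -> R) : Prop :=
  forall (phi : R -> R) a b, rsmooth phi -> 0 < a ->
    (forall r, r \notin `[a, b] -> phi r = 0) ->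
    \int[mu]_(r in H) (u r * derive1 phi r) = - \int[mu]_(r in H) (beta r * phi r).

(** Test against phi_n(r) = s(n (r - x)) - s(n (r - y)), which tends to the
    indicator of ]x, y] while staying in [0, 1].  Its derivative is the difference
    of two approximate identities, so the left-hand side tends to u x - u y; the
    right-hand side converges by domination. *)
Lemma weak_derivative_increment u beta (x y : R) :
  (forall r, 0 < r -> {for r, continuous u}) -> locint beta ->
  weak_derivative u beta -> 0 < x -> x < y ->
  u y - u x = \int[mu]_(r in `]x, y]) beta r.
Proof.
move=> cu lb wub x0 xy; have y0 := lt_trans x0 xy.
have [s [rho [ds Arho rho_ge0 [s0 s1] [s01 rho_out]]]] := smooth_step.
have crho : continuous rho.
  have [g _ dg] := flat_algebra_derive (Arho 0 1).
  move=> t; move: (is_derive_continuous (dg t)).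
  by under [X in {for _, continuous X}]eq_fun do rewrite add0r mul1r.
have step01 : s 1 - s 0 = 1 by rewrite (s0 0)// (s1 1)// subr0.
have ai z : 0 < z -> \int[mu]_(r in H) (u r * (n.+1%:R * rho (n.+1%:R * (r - z))))
    @[n --> \oo] --> u z.
  by move=> z0; apply: approximate_identity => //; exists s.
pose phi n r := s (n.+1%:R * (r - x)) - s (n.+1%:R * (r - y)).
pose psi n z r := n.+1%:R * rho (n.+1%:R * (r - z)).
have dphi n r : is_derive r 1 (phi n) (psi n x r - psi n y r).
  have d1 z : is_derive r 1 (fun t => n.+1%:R * (t - z)) n.+1%:R.
    by apply: is_derive_eq; rewrite subr0 /GRing.scale /= mulr1.
  by rewrite /psi ![n.+1%:R * rho _]mulrC; apply: is_deriveB.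
have Apsi n z : flat_algebra (psi n z).
  apply: flat_algebra_scale.
  rewrite [X in flat_algebra X](_ : _ = fun r => rho (- (n.+1%:R * z) + n.+1%:R * r)).
    exact: Arho.
  by apply/funext => r; congr rho; rewrite mulrBr addrC.
have sphi n : rsmooth (phi n).
  apply: (rsmooth_primitive (dphi n)); apply: flat_algebra_smooth.
  rewrite [X in flat_algebra X](_ : _ = fun r => psi n x r + (-1) * psi n y r).
    by apply: flat_algebra_add => //; exact: flat_algebra_scale.
  by apply/funext => r; rewrite mulN1r.
have s_le0 n z r : r <= z -> s (n.+1%:R * (r - z)) = 0.
  by move=> rz; rewrite s0// pmulr_rle0// subr_le0.
have s_ge1 n z r : z + n.+1%:R^-1 <= r -> s (n.+1%:R * (r - z)) = 1.
  by move=> zr; rewrite s1// -ler_pdivrMl// mulr1 lerBrDl.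
have invn1 n : (n.+1%:R^-1 : R) <= 1 by rewrite invf_le1// ler1n.
have phi_out n r : r \notin `[x, y + 1] -> phi n r = 0.
  rewrite in_itv /= negb_and -!ltNge /phi => /orP[rx|yr].
    by rewrite !s_le0 ?subr0// ltW// (lt_trans rx xy).
  have yNr : y + n.+1%:R^-1 <= r by rewrite (le_trans _ (ltW yr))// lerD2l invn1.
  by rewrite (s_ge1 n x) ?(s_ge1 n y) ?subrr// (le_trans _ yNr)// lerD2r ltW.
have phi_le1 n r : `|phi n r| <= 1.
  have /andP[p1 p2] := s01 (n.+1%:R * (r - x)).
  have /andP[p3 p4] := s01 (n.+1%:R * (r - y)).
  by rewrite /phi ler_norml; apply/andP; split; lra.
pose chi r : R := \1_`]x, y] r.
have phi_cvg r : phi n r @[n --> \oo] --> chi r.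
  rewrite /chi indicE; apply: cvg_near_cst.
  have [rx|xr] := leP r x.
    near=> n; rewrite /phi !s_le0 ?subr0 ?(le_trans rx) ?(ltW xy)//.
    by rewrite memNset//= in_itv /= ltNge rx.
  have s1x z : z < r -> \forall n \near \oo, s (n.+1%:R * (r - z)) = 1.
    move=> zr; have rz : 0 < r - z by rewrite subr_gt0.
    near=> n; rewrite s_ge1// -lerBrDl ltW//.
    near: n; exact: (near_infty_natSinv_lt (PosNum rz)).
  have [ry|yr] := leP r y.
    near=> n; rewrite /phi (s_le0 _ _ _ ry) subr0.
    rewrite mem_set /= ?in_itv /= ?xr ?ry//.
    by near: n; exact: s1x.
  near=> n; rewrite /phi memNset /= ?in_itv /= ?xr ?leNgt ?yr//=.
  rewrite (_ : s (n.+1%:R * (r - x)) = 1); last by near: n; exact: s1x.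
  rewrite (_ : s (n.+1%:R * (r - y)) = 1) ?subrr//.
  by near: n; exact: s1x.
have cphi n : continuous (phi n) by move=> r; exact: is_derive_continuous (dphi n r).
have mD : measurable (`[x, y + 1]%classic : set RM) by [].
have lbD := lb x (y + 1) x0.
have mb : measurable_fun (`[x, y + 1]%classic : set RM) beta.
  by apply/measurable_EFinP; exact: (measurable_int mu).
(* The dominating function is |beta|, on the compact interval that contains
   all the supports. *)
have lim_beta : \int[mu]_(r in H) (beta r * phi n r) @[n --> \oo] -->
    \int[mu]_(r in `]x, y]) beta r.
  have [|||||ichi _ limE] := @dominated_convergence _ _ _ mu _ mD
      (fun n => EFin \o (fun r => beta r * phi n r))
      (EFin \o (fun r => beta r * chi r)) (EFin \o (fun r => `|beta r|)).
  - move=> n; apply/measurable_EFinP; apply: measurable_funM => //.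
    by apply: measurable_funTS; exact: continuous_measurable_fun.
  - apply/measurable_EFinP; apply: measurable_funM => //.
    by apply: measurable_funTS; exact: measurable_indic.
  - apply: aeW => r _ /=; apply: cvg_EFin; first exact: nearW.
    exact: cvgMl_tmp (phi_cvg r).
  - exact: integrable_norm.
  - apply: aeW => r n _ /=; rewrite lee_fin normrM ler_piMr//.
  have -> : \int[mu]_(r in `]x, y]) beta r =
      \int[mu]_(r in `[x, y + 1]) (beta r * chi r).
    rewrite Rintegral_mkcond [RHS]Rintegral_mkcond.
    congr (Rintegral _ _ _); apply/funext => r; rewrite !patchE /chi indicE.
    case: (boolP (r \in `]x, y]%classic)) => rxy; last by rewrite mulr0 if_same.
    rewrite mulr1 mem_set//; move: rxy; rewrite inE /= !in_itv /= => /andP[xr ry].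
    by rewrite ltW//= (le_trans ry)// lerDl.
  have -> : (fun n => \int[mu]_(r in H) (beta r * phi n r)) =
      (fun n => \int[mu]_(r in `[x, y + 1]) (beta r * phi n r)).
    apply/funext => n; apply: Rintegral_support => // r /phi_out ->.
    by rewrite mulr0.
  apply: fine_cvg; rewrite fineK; first exact: limE.
  exact: integrable_fin_num.
have lim_u : \int[mu]_(r in H) (u r * derive1 (phi n) r) @[n --> \oo] --> u x - u y.
  have -> : (fun n => \int[mu]_(r in H) (u r * derive1 (phi n) r)) =
     (fun n => \int[mu]_(r in H) (u r * psi n x r)
             - \int[mu]_(r in H) (u r * psi n y r)).
    apply/funext => n.
    have iu z : 0 < z -> integ H (fun r => u r * psi n z r).
      move=> z0.
      have out r : r \notin `[z, z + n.+1%:R^-1] -> u r * psi n z r = 0.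
        rewrite in_itv /= negb_and -!ltNge /psi => /orP[rz|zr].
          by rewrite rho_out ?mulr0// negb_and -leNgt pmulr_rle0// subr_le0 ltW.
        rewrite rho_out ?mulr0// negb_and -!leNgt orbC -ler_pdivrMl// mulr1.
        by rewrite lerBrDl ltW.
      apply: (integ_support z0 out); apply: locintM => //.
      apply: continuous_locint => r _.
      by have [g _ dg] := flat_algebra_derive (Apsi n z); exact: is_derive_continuous (dg r).
    rewrite -RintegralB ?iu//; last exact: measurable_halfline.
    apply: eq_Rintegral => r _.
    by rewrite (is_derive_derive1 (dphi n r)) mulrBr.
  by apply: cvgB; exact: ai.
have lim_u' : \int[mu]_(r in H) (u r * derive1 (phi n) r) @[n --> \oo] -->
    - \int[mu]_(r in `]x, y]) beta r.
  have -> : (fun n => \int[mu]_(r in H) (u r * derive1 (phi n) r)) =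
     (fun n => - \int[mu]_(r in H) (beta r * phi n r)).
    apply/funext => n; apply: wub (sphi n) x0 _; exact: phi_out.
  exact: cvgN.
have E : u x - u y = - \int[mu]_(r in `]x, y]) beta r.
  exact: (cvg_unique (@norm_hausdorff _ _) lim_u lim_u').
by rewrite -opprB E opprK.
Unshelve. all: by end_near. Qed.

End DuBoisReymond.

(** * Primitives of square-integrable functions *)

Section Primitive.
Context {R : realType}.
Local Notation mu := (@lebesgue_measure R).
Local Notation H := (@halfline R).
Local Notation RM := (measurableTypeR R).
Local Notation integ A f := (mu.-integrable A (EFin \o f)).
Implicit Types (f g u beta w : R -> R) (a b c t r x y : R).

(** This is 2 |beta| <= c w beta^2 + 1 / (c w), integrated.  It replaces the
    Cauchy-Schwarz inequality, the parameter c being optimized by the user. *)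
Lemma Rintegral_amgm (A : set RM) beta w c : measurable A -> 0 < c ->
  (forall r, A r -> 0 < w r) -> integ A beta ->
  integ A (fun r => beta r ^+ 2 * w r) -> integ A (fun r => (w r)^-1) ->
  `|\int[mu]_(r in A) beta r| <=
    c / 2 * \int[mu]_(r in A) (beta r ^+ 2 * w r)
    + (2 * c)^-1 * \int[mu]_(r in A) (w r)^-1.
Proof.
move=> mA c0 w0 ib ibw iw.
apply: (le_trans (le_normr_Rintegral mA ib)).
rewrite -!RintegralZl// -RintegralD//; [|exact: integZ|exact: integZ].
apply: le_Rintegral => //.
- exact: integrable_norm.
- by apply: integD => //; exact: integZ.
move=> r Ar; have wr := w0 _ Ar.
have wn : w r != 0 by rewrite gt_eqF.
have cn : c != 0 by rewrite gt_eqF.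
rewrite -subr_ge0.
have -> : c / 2 * (beta r ^+ 2 * w r) + (2 * c)^-1 * (w r)^-1 - `|beta r| =
  (c * w r * `|beta r| - 1) ^+ 2 / (2 * c * w r).
  by rewrite -[beta r ^+ 2]real_normK ?num_real//; field; rewrite wn cn.
by rewrite divr_ge0 ?sqr_ge0// !mulr_ge0// ltW.
Qed.

Definition primitive beta x : R := \int[mu]_(r in `]0, x[) beta r.

Lemma primitive0 beta : primitive beta 0 = 0.
Proof. by rewrite /primitive set_itv_ge ?Rintegral_set0// bnd_simp ltxx. Qed.

Lemma itv_oo_halfline x y : 0 <= x -> `]x, y[ `<=` H.
Proof. by move=> x0 r /=; rewrite in_itv /= => /andP[/(le_lt_trans x0)]. Qed.

Lemma sqint_integ_oo beta x y : sqint beta -> 0 <= x -> integ `]x, y[ beta.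
Proof.
move=> sb x0; apply: sqint_integrable_finite => //.
  exact: itv_oo_halfline.
exact: mu_itv_fin.
Qed.

Lemma sqint_integ_oc beta x y : sqint beta -> 0 <= x -> integ `]x, y] beta.
Proof.
move=> sb x0; apply: sqint_integrable_finite => //.
  exact: itv_oc_halfline.
exact: mu_itv_fin.
Qed.

Lemma primitive_increment beta x y : sqint beta -> 0 <= x -> x <= y ->
  primitive beta y - primitive beta x = \int[mu]_(r in `]x, y[) beta r.
Proof.
move=> sb x0 xy; rewrite /primitive.
rewrite !Rintegral_itv_bndo_bndc; try exact: sqint_integ_oo.
by rewrite Rintegral_itvB ?bnd_simp//; exact: sqint_integ_oc.
Qed.

Lemma primitive_increment_le beta c x y : sqint beta -> 0 < c -> 0 <= x -> x <= y ->
  `|primitive beta y - primitive beta x| <=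
    c / 2 * \int[mu]_(r in `]x, y[) (beta r ^+ 2) + (2 * c)^-1 * (y - x).
Proof.
move=> sb c0 x0 xy; rewrite primitive_increment//.
have mI : measurable (`]x, y[%classic : set RM) by [].
have iI : integ `]x, y[ (fun r => beta r ^+ 2 * cst 1 r).
  rewrite (_ : (fun _ => _) = fun r => beta r ^+ 2); last first.
    by apply/funext => r; rewrite mulr1.
  apply: integ_sub (sqint_integrable sb) => //; last exact: itv_oo_halfline.
  exact: measurable_halfline.
have i1 : integ `]x, y[ (fun r => (cst 1 r)^-1).
  exact: (integ_cst 1^-1 mI (mu_itv_fin _ _ _ _)).
have := Rintegral_amgm mI c0 (fun _ _ => ltr01) (sqint_integ_oo y sb x0) iI i1.
congr (_ <= _ * _ + _ * _).
  by apply: eq_Rintegral => r _; rewrite mulr1.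
rewrite (_ : (fun r => _) = cst 1); last by apply/funext => r; rewrite invr1.
rewrite Rintegral_cst// mul1r /= lebesgue_measure_itv /= lte_fin.
by case: ltP => // yx; have -> : y = x; [apply/eqP; rewrite eq_le yx|rewrite subrr].
Qed.

(** The integral of a nonnegative function is superadditive over disjoint
    intervals. *)
Lemma Rintegral_disjoint_itv_le f n (x y : 'I_n -> R) :
  integ H f -> (forall r, 0 < r -> 0 <= f r) -> (forall i, 0 <= x i) ->
  trivIset [set: 'I_n] (fun i => [set t | x i < t < y i]) ->
  \sum_(i < n) \int[mu]_(r in `]x i, y i[) f r <= \int[mu]_(r in H) f r.
Proof.
move=> iF f0 x0 tI.
have mH := @measurable_halfline R.
pose F i : set RM := `]x i, y i[%classic.
have FH i : F i `<=` H by exact: itv_oo_halfline.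
have DH : \big[setU/set0]_(i <- enum 'I_n) F i `<=` H.
  by apply: (big_ind (fun A => A `<=` H)) => // A B AH BH r [/AH|/BH].
have iD (D : set RM) : measurable D -> D `<=` H -> integ D f.
  by move=> mD DsH; apply: integ_sub iF.
have mbig : measurable (\big[setU/set0]_(i <- enum 'I_n) F i).
  by apply: bigsetU_measurable => i _; exact: measurable_itv.
have tF : trivIset [set: 'I_n] F.
  have -> : F = (fun i => [set t | x i < t < y i]) by apply/funext => i; rewrite /F set_itvoo.
  exact: tI.
rewrite -lee_fin -sumEFin fineK; last exact: integrable_fin_num.
have -> : (\sum_(i < n) (\int[mu]_(r in `]x i, y i[) f r)%:E =
    \sum_(i <- enum 'I_n) \int[mu]_(r in F i) (f r)%:E)%E.
  rewrite big_enum /=; apply: eq_bigr => i _; rewrite fineK//.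
  have mFi : measurable (F i) by exact: measurable_itv.
  exact: (integrable_fin_num mFi (iD _ mFi (FH i))).
rewrite -ge0_integral_bigsetU//=.
- apply: ge0_subset_integral => //.
  by case/integrableP: iF.
- by move=> i; exact: measurable_itv.
- exact: enum_uniq.
- exact: sub_trivIset tF.
- by case/integrableP: (iD _ mbig DH).
- by move=> r /DH; rewrite lee_fin; exact: f0.
Qed.

(** Sum the bound [primitive_increment_le] over the intervals: the terms with
    beta^2 add up to at most c / 2 times the total energy, which a small c makes
    small; then the total length is taken small compared with c. *)
Lemma primitive_absolutely_continuous beta (eps : R) : sqint beta -> 0 < eps ->
  exists2 delta : R, 0 < delta & forall n (x y : 'I_n -> R),
    (forall i, 0 <= x i <= y i) ->
    trivIset [set: 'I_n] (fun i => [set t | x i < t < y i]) ->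
    \sum_(i < n) (y i - x i) < delta ->
    \sum_(i < n) `|primitive beta (y i) - primitive beta (x i)| < eps.
Proof.
move=> sb e0.
have ib := sqint_integrable sb.
pose B := \int[mu]_(r in H) (beta r ^+ 2).
have B0 : 0 <= B by apply: Rintegral_ge0 => r _; exact: sqr_ge0.
(* This choice makes c B <= eps, even when the energy B vanishes. *)
pose c := eps / (B + 1).
have c0 : 0 < c by rewrite divr_gt0// ltr_wpDl.
exists (c * eps); first exact: mulr_gt0.
move=> n x y xy tI sumxy.
have x0 i : 0 <= x i by case/andP: (xy i).
have xyi i : x i <= y i by case/andP: (xy i).
apply: (@le_lt_trans _ _ (\sum_(i < n)
   (c / 2 * \int[mu]_(r in `]x i, y i[) (beta r ^+ 2) + (2 * c)^-1 * (y i - x i)))).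
  by apply: ler_sum => i _; exact: primitive_increment_le.
rewrite big_split/= -!mulr_sumr.
have h1 : c / 2 * (\sum_(i < n) \int[mu]_(r in `]x i, y i[) (beta r ^+ 2)) <= c / 2 * B.
  have c20 : 0 <= c / 2 by apply: ltW; rewrite divr_gt0.
  apply: ler_wpM2l => //.
  by apply: Rintegral_disjoint_itv_le => // r _; exact: sqr_ge0.
have h2 : (2 * c)^-1 * (\sum_(i < n) (y i - x i)) < eps / 2.
  have c2 : 0 < 2 * c by exact: mulr_gt0.
  rewrite (ltr_pdivrMl _ _ c2).
  have -> : 2 * c * (eps / 2) = c * eps by field.
  exact: sumxy.
have h3 : c * B <= eps.
  rewrite /c mulrAC ler_pdivrMr ?ltr_wpDl// ler_wpM2l ?(ltW e0)//.
  by rewrite lerDl.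
apply: (lt_le_trans (ler_ltD h1 h2)).
by rewrite mulrAC -mulrDl; lra.
Qed.

Lemma primitive_uniformly_continuous beta (eps : R) : sqint beta -> 0 < eps ->
  exists2 delta : R, 0 < delta & forall x y, 0 <= x -> 0 <= y -> `|y - x| < delta ->
    `|primitive beta y - primitive beta x| < eps.
Proof.
move=> sb e0; have [d d0 Hd] := primitive_absolutely_continuous sb e0.
exists d => // x y.
wlog xy : x y / x <= y => [wl x0 y0 xyd|x0 y0 xyd].
  have [xy|/ltW yx] := leP x y; first exact: wl.
  by rewrite distrC; apply: wl => //; rewrite distrC.
have := Hd 1%N (fun=> x) (fun=> y); rewrite !big_ord1; apply.
- by move=> _; rewrite x0.
- by move=> i j _ _ _; rewrite (ord1 i) (ord1 j).
- by apply: le_lt_trans xyd; exact: ler_norm.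
Qed.

Lemma primitive_continuous beta x : sqint beta -> 0 < x ->
  {for x, continuous (primitive beta)}.
Proof.
move=> sb x0; apply/cvgrPdist_lt => e e0.
have [d d0 Hd] := primitive_uniformly_continuous sb e0.
near=> y; rewrite distrC; apply: Hd; first exact: ltW.
  by apply: ltW; near: y; exact: lt_nbhsr.
rewrite distrC; near: y; apply/nbhs_ballP; exists d => //=.
Unshelve. all: by end_near. Qed.

End Primitive.

(** * Hardy's inequality *)

Section Hardy.
Context {R : realType}.
Local Notation mu := (@lebesgue_measure R).
Local Notation H := (@halfline R).
Local Notation RM := (measurableTypeR R).
Local Notation integ A f := (mu.-integrable A (EFin \o f)).
Implicit Types (f g u beta w : R -> R) (a b c t r x y : R).

Let mH := @measurable_halfline R.

Lemma Rintegral_oo_cc f x y : integ `[x, y] f ->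
  \int[mu]_(r in `]x, y[) f r = \int[mu]_(r in `[x, y]) f r.
Proof.
move=> iF.
have mcc : measurable (`[x, y]%classic : set RM) by exact: measurable_itv.
rewrite Rintegral_itv_bndo_bndc ?Rintegral_itv_obnd_cbnd//.
  by apply: integ_sub iF => //; exact: subset_itv_oc_cc.
by apply: integ_sub iF => //; exact: subset_itv_oo_cc.
Qed.

Lemma sqrt_derive r : 0 < r -> is_derive r 1 (fun t => 2 * Num.sqrt t) (Num.sqrt r)^-1.
Proof.
move=> r0.
have d := is_derive1_sqrt r0.
have -> : (Num.sqrt r)^-1 = 2 * (2 * Num.sqrt r)^-1.
  by field; rewrite gt_eqF// sqrtr_gt0.
exact: is_deriveZ.
Qed.

Lemma continuous_invsqrt r : 0 < r -> {for r, continuous (fun t => (Num.sqrt t)^-1)}.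
Proof.
move=> r0; apply: cvgV; first by rewrite gt_eqF// sqrtr_gt0.
exact: sqrt_continuous.
Qed.

Lemma Rintegral_invsqrt_le x y : 0 < x -> x < y ->
  \int[mu]_(r in `]x, y[) (Num.sqrt r)^-1 <= 2 * Num.sqrt y.
Proof.
move=> x0 xy; rewrite Rintegral_oo_cc; last first.
  by apply: continuous_locint => // r; exact: continuous_invsqrt.
have dF r : x <= r <= y -> is_derive r 1 (fun t => 2 * Num.sqrt t) (Num.sqrt r)^-1.
  by move=> /andP[xr _]; apply: sqrt_derive; exact: lt_le_trans xr.
have cF r : x <= r <= y -> {for r, continuous (fun t => (Num.sqrt t)^-1)}.
  by move=> /andP[xr _]; apply: continuous_invsqrt; exact: lt_le_trans xr.
by rewrite (Rintegral_is_derive xy dF cF) lerBlDr lerDl mulr_ge0// sqrtr_ge0.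
Qed.

Lemma sqint_sqrt_weight beta x y : sqint beta -> 0 <= x ->
  integ `]x, y[ (fun r => beta r ^+ 2 * Num.sqrt r).
Proof.
move=> sb x0.
have mI : measurable (`]x, y[%classic : set RM) by [].
have IH : `]x, y[ `<=` H by exact: itv_oo_halfline.
have i2 := integ_sub mH mI IH (sqint_integrable sb).
apply: integ_le (integZ (Num.sqrt y) mI i2) => //.
  apply: measurable_funM.
    by apply: measurable_funX; apply: measurable_funS (sb.1).
  apply: measurable_funTS; apply: continuous_measurable_fun.
  exact: sqrt_continuous.
move=> r /=; rewrite in_itv /= => /andP[_ ry].
rewrite !normrM mulrC ler_wpM2r//.
by rewrite !ger0_norm ?sqrtr_ge0// ler_wsqrtr// ltW.
Qed.

(** Weighted Cauchy-Schwarz with weight sqrt s: the integral of 1 / sqrt s over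
    ]0, r[ is 2 sqrt r.  The increments from x > 0 are bounded first, and then
    x tends to 0. *)
Lemma primitive_sq_le beta r : sqint beta -> 0 < r ->
  primitive beta r ^+ 2 <=
    2 * Num.sqrt r * \int[mu]_(s in `]0, r[) (beta s ^+ 2 * Num.sqrt s).
Proof.
move=> sb r0; set W := Rintegral _ _ _; set U := primitive beta r.
have W0 : 0 <= W.
  by apply: Rintegral_ge0 => s _; rewrite mulr_ge0 ?sqr_ge0 ?sqrtr_ge0.
have q0 : 0 < Num.sqrt r by rewrite sqrtr_gt0.
have key c : 0 < c -> `|U| <= c / 2 * W + Num.sqrt r / c.
  move=> c0; apply/ler_addgt0Pr => eta eta0.
  have [d d0 Hd] := primitive_uniformly_continuous sb eta0.
  (* A base point at which the primitive is already smaller than eta. *)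
  pose x := Num.min (d / 2) (r / 2).
  have x0 : 0 < x by rewrite lt_min !divr_gt0.
  have xd : x < d by rewrite gt_min; apply/orP; left; lra.
  have xr : x < r by rewrite gt_min; apply/orP; right; lra.
  have Ux : `|primitive beta x| <= eta.
    have := Hd 0 x (lexx _) (ltW x0); rewrite primitive0 !subr0 ger0_norm ?(ltW x0)//.
    by move=> /(_ xd)/ltW.
  have mI : measurable (`]x, r[%classic : set RM) by [].
  have w0 s : `]x, r[%classic s -> 0 < Num.sqrt s.
    by rewrite /= in_itv /= sqrtr_gt0 => /andP[/(lt_trans x0)].
  have iw : integ `]x, r[ (fun s => (Num.sqrt s)^-1).
    have : integ `[x, r] (fun s => (Num.sqrt s)^-1).
      by apply: continuous_locint => // s; exact: continuous_invsqrt.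
    by apply: integ_sub => //; exact: subset_itv_oo_cc.
  have := Rintegral_amgm mI c0 w0 (sqint_integ_oo r sb (ltW x0))
    (sqint_sqrt_weight r sb (ltW x0)) iw.
  rewrite -(primitive_increment sb (ltW x0) (ltW xr)) -/U => h.
  have hW : \int[mu]_(s in `]x, r[) (beta s ^+ 2 * Num.sqrt s) <= W.
    have i0 := sqint_sqrt_weight r sb (lexx 0).
    have mI0 : measurable (`]0, r[%classic : set RM) by [].
    have i1 := sqint_sqrt_weight r sb (ltW x0).
    rewrite -lee_fin (fineK (integrable_fin_num mI i1)) (fineK (integrable_fin_num mI0 i0)).
    apply: ge0_subset_integral => //.
    - by case/integrableP: i0.
    - by move=> s _; rewrite lee_fin mulr_ge0 ?sqr_ge0 ?sqrtr_ge0.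
    - by apply: subset_itvr; rewrite bnd_simp ltW.
  have hq := Rintegral_invsqrt_le x0 xr.
  have h1 : c / 2 * \int[mu]_(s in `]x, r[) (beta s ^+ 2 * Num.sqrt s) <= c / 2 * W.
    by apply: ler_wpM2l => //; apply: ltW; rewrite divr_gt0.
  have h2 : (2 * c)^-1 * \int[mu]_(s in `]x, r[) (Num.sqrt s)^-1 <= Num.sqrt r / c.
    have -> : Num.sqrt r / c = (2 * c)^-1 * (2 * Num.sqrt r).
      by field; rewrite gt_eqF.
    by apply: ler_wpM2l => //; rewrite invr_ge0 mulr_ge0// ltW.
  apply: (@le_trans _ _ (`|U - primitive beta x| + `|primitive beta x|)).
    by rewrite -[X in `|X| <= _](subrK (primitive beta x)) ler_normD.
  by rewrite lerD// (le_trans h)// lerD.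
have [U0|Un0] := eqVneq U 0.
  by rewrite U0 expr0n /= mulr_ge0// mulr_ge0// ltW.
have nU : 0 < `|U| by rewrite normr_gt0.
(* The value of c that balances the two terms of the bound. *)
have := key (2 * Num.sqrt r / `|U|).
rewrite divr_gt0 ?mulr_gt0// => /(_ isT) h.
have : `|U| * `|U| <= `|U| * (2 * Num.sqrt r / `|U| / 2 * W
   + Num.sqrt r / (2 * Num.sqrt r / `|U|)).
  by apply: ler_wpM2l => //; exact: ltW.
have -> : `|U| * (2 * Num.sqrt r / `|U| / 2 * W
   + Num.sqrt r / (2 * Num.sqrt r / `|U|)) = Num.sqrt r * W + `|U| * `|U| / 2.
  by field; rewrite (gt_eqF nU) (gt_eqF q0).
rewrite -[U ^+ 2]real_normK ?num_real// expr2; lra.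
Qed.

(** The antiderivative is - 4 / sqrt r. *)
Lemma integral_hardy_kernel_le s : 0 < s ->
  (\int[mu]_(r in `[s, +oo[) (2 / (r * Num.sqrt r))%:E <= (4 / Num.sqrt s)%:E)%E.
Proof.
move=> s0.
have cg r : 0 < r -> {for r, continuous (fun t => 2 / (t * Num.sqrt t))}.
  move=> r0; apply: cvgMl_tmp; apply: cvgV.
    by rewrite gt_eqF// mulr_gt0// sqrtr_gt0.
  by apply: cvgM; [exact: cvg_id|exact: sqrt_continuous].
have dG r : 0 < r -> is_derive r 1 (fun t => - 4 * (Num.sqrt t)^-1) (2 / (r * Num.sqrt r)).
  move=> r0.
  have q0 : Num.sqrt r != 0 by rewrite gt_eqF// sqrtr_gt0.
  have d := is_deriveV q0 (is_derive1_sqrt r0).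
  apply: is_derive_eq.
  rewrite /GRing.scale /=.
  have -> : r * Num.sqrt r = Num.sqrt r ^+ 3 by rewrite exprS sqr_sqrtr ?ltW// mulrC.
  by field.
have sH : `[s, +oo[ `<=` H.
  by move=> r /=; rewrite in_itv /= andbT => /(lt_le_trans s0).
have ms : measurable (`[s, +oo[%classic : set RM) by [].
have mg : measurable_fun H (fun r => 2 / (r * Num.sqrt r)).
  apply: open_continuous_measurable_fun; first by rewrite halflineE.
  by move=> r; rewrite inE => /cg.
apply: exhaustion_integral_le => //.
- exact: measurable_funS mg.
- by move=> r /sH r0; rewrite divr_ge0// mulr_ge0 ?sqrtr_ge0// ltW.
move=> a b a0 ab.
pose a' := Num.max s a.
have a'0 : 0 < a' by rewrite lt_max s0.
have -> : `[s, +oo[ `&` `[a, b] = `[a', b]%classic.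
  apply/seteqP; split=> r; rewrite /= !in_itv /= andbT ge_max.
    by move=> [-> /andP[-> ->]].
  by move=> /andP[/andP[-> ->] ->].
have [a'b|ba'] := ltP a' b; last first.
  have [/eqP->|?] := boolP (a' == b).
    by rewrite set_itv1 integral_set1 lee_fin divr_ge0// sqrtr_ge0.
  rewrite set_itv_ge ?integral_set0 ?lee_fin ?divr_ge0 ?sqrtr_ge0//.
  by rewrite bnd_simp -ltNge lt_neqAle eq_sym ba' andbT.
have h1 : 0 <= 4 * (Num.sqrt b)^-1 by rewrite mulr_ge0// invr_ge0 sqrtr_ge0.
have h2 : (Num.sqrt a')^-1 <= (Num.sqrt s)^-1.
  by rewrite lef_pV2 ?posrE ?sqrtr_gt0// ler_wsqrtr// le_max lexx.
have dG' r : a' <= r <= b ->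
    is_derive r 1 (fun t => - 4 * (Num.sqrt t)^-1) (2 / (r * Num.sqrt r)).
  by move=> /andP[ar _]; apply: dG; exact: lt_le_trans ar.
have cg' r : a' <= r <= b -> {for r, continuous (fun t => 2 / (t * Num.sqrt t))}.
  by move=> /andP[ar _]; apply: cg; exact: lt_le_trans ar.
by rewrite (integral_is_derive a'b dG' cg') lee_fin; lra.
Qed.

Lemma ge0_integral_scale (D : set RM) f c : measurable D -> measurable_fun D f ->
  (forall r, D r -> 0 <= f r) -> 0 <= c ->
  (\int[mu]_(r in D) (c * f r)%:E = c%:E * \int[mu]_(r in D) (f r)%:E)%E.
Proof.
move=> mD mf f0 c0.
have mEf : measurable_fun D (EFin \o f) by exact/measurable_EFinP.
by under eq_integral do rewrite EFinM; apply: ge0_integralZl_EFin.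
Qed.

Lemma integral_if (D : set RM) f :
  (\int[mu]_(r in D) (f r)%:E = \int[mu]_r (if r \in D then f r else 0)%:E)%E.
Proof.
rewrite integral_mkcond epatch_indic; apply: eq_integral => r _ /=.
by rewrite indicE -EFinM; case: (r \in D); rewrite ?mulr1 ?mulr0.
Qed.

Lemma measurable_fun_if_set (D : set RM) f : measurable D -> measurable_fun D f ->
  measurable_fun setT (fun r : RM => if r \in D then f r else 0).
Proof.
move=> mD /(measurable_restrictT _ mD); rewrite patch_indic.
congr (measurable_fun _ _); apply/funext => r /=.
by rewrite indicE; case: (r \in D); rewrite ?mulr1 ?mulr0.
Qed.

Lemma mem_halfline r : (r \in H) = (0 < r).
Proof. by apply/idP/idP; rewrite inE. Qed.

(** Dividing [primitive_sq_le] by r^2 leaves this weight in front of the integral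
    of beta^2 sqrt s over ]0, r[. *)
Definition hardy_weight r : R := 2 / (r * Num.sqrt r).

Lemma hardy_weight_ge0 r : 0 < r -> 0 <= hardy_weight r.
Proof. by move=> r0; rewrite divr_ge0// mulr_ge0 ?sqrtr_ge0// ltW. Qed.

Lemma measurable_hardy_weight : measurable_fun H hardy_weight.
Proof.
apply: open_continuous_measurable_fun; first by rewrite halflineE.
move=> r; rewrite inE => r0; apply: cvgMl_tmp; apply: cvgV.
  by rewrite gt_eqF// mulr_gt0// sqrtr_gt0.
by apply: cvgM; [exact: cvg_id|exact: sqrt_continuous].
Qed.

(** The integrand of the double integral over 0 < s <= r to which Tonelli's theorem
    is applied, extended by 0 to the plane. *)
Definition hardy_kernel beta r s : R :=
  if s <= r then (if 0 < r then hardy_weight r else 0)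
                 * (if 0 < s then beta s ^+ 2 * Num.sqrt s else 0)
  else 0.

Lemma hardy_kernel_ge0 beta r s : 0 <= hardy_kernel beta r s.
Proof.
rewrite /hardy_kernel; case: ifP => // _; apply: mulr_ge0; case: ifP => // p0.
  exact: hardy_weight_ge0.
by rewrite mulr_ge0 ?sqr_ge0 ?sqrtr_ge0.
Qed.

Lemma measurable_hardy_kernel beta : sqint beta ->
  measurable_fun setT (fun z : RM * RM => (hardy_kernel beta z.1 z.2)%:E).
Proof.
move=> sb.
have mg : measurable_fun setT (fun r : RM => if 0 < r then hardy_weight r else 0).
  have := measurable_fun_if_set mH measurable_hardy_weight.
  by under eq_fun do rewrite mem_halfline.
have mh : measurable_fun setT
    (fun s : RM => if 0 < s then beta s ^+ 2 * Num.sqrt s else 0).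
  have mb : measurable_fun H (fun s => beta s ^+ 2 * Num.sqrt s).
    apply: measurable_funM; first by apply: measurable_funX; case: sb.
    by apply: measurable_funTS; apply: continuous_measurable_fun; exact: sqrt_continuous.
  have := measurable_fun_if_set mH mb.
  by under eq_fun do rewrite mem_halfline.
apply/measurable_EFinP; apply: measurable_fun_ifT => //.
  by apply: measurable_fun_ler; [exact: measurable_snd|exact: measurable_fst].
apply: measurable_funM.
- exact: (measurableT_comp mg measurable_fst).
- exact: (measurableT_comp mh measurable_snd).
Qed.

(** Integrating the weight over r >= s gives 4 / sqrt s, which cancels sqrt s. *)
Lemma integral_hardy_kernel_l beta s :
  (\int[mu]_r (hardy_kernel beta r s)%:E <=
     (if s \in H then 4 * beta s ^+ 2 else 0)%:E)%E.
Proof.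
rewrite mem_halfline; have [s0|s0] := ltP 0 s; last first.
  have K_eq0 r : (hardy_kernel beta r s)%:E = 0%E.
    by rewrite /hardy_kernel (ltNge 0 s) s0 mulr0 if_same.
  under eq_integral do rewrite K_eq0.
  by rewrite integral0 lee_fin lexx.
have ms : measurable (`[s, +oo[%classic : set RM) by [].
have sH : `[s, +oo[ `<=` H.
  by move=> r /=; rewrite in_itv /= andbT => /(lt_le_trans s0).
have k0 r : `[s, +oo[%classic r -> 0 <= hardy_weight r.
  by move=> /sH; exact: hardy_weight_ge0.
have bs0 : 0 <= beta s ^+ 2 * Num.sqrt s by rewrite mulr_ge0 ?sqr_ge0 ?sqrtr_ge0.
have -> : (\int[mu]_r (hardy_kernel beta r s)%:E =
    (beta s ^+ 2 * Num.sqrt s)%:E * \int[mu]_(r in `[s, +oo[) (hardy_weight r)%:E)%E.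
  rewrite -(ge0_integral_scale ms (measurable_funS mH sH measurable_hardy_weight) k0 bs0).
  rewrite [RHS]integral_if; apply: eq_integral => r _.
  rewrite /hardy_kernel; have [sr|rs] := leP s r.
    rewrite mem_set /= ?in_itv /= ?sr// s0 (lt_le_trans s0 sr).
    by rewrite mulrC.
  by rewrite memNset//= in_itv /= andbT leNgt rs.
apply: (@le_trans _ _ ((beta s ^+ 2 * Num.sqrt s)%:E * (4 / Num.sqrt s)%:E)%E).
  by apply: lee_wpmul2l; [rewrite lee_fin|exact: integral_hardy_kernel_le].
rewrite -EFinM lee_fin le_eqVlt; apply/orP; left; apply/eqP.
by field; rewrite gt_eqF// sqrtr_gt0.
Qed.

Lemma integral_hardy_kernel_r beta r : sqint beta ->
  ((if r \in H then (primitive beta r / r) ^+ 2 else 0)%:E <=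
    \int[mu]_s (hardy_kernel beta r s)%:E)%E.
Proof.
move=> sb; rewrite mem_halfline; have [r0|r0] := ltP 0 r; last first.
  by apply: integral_ge0 => s _; rewrite lee_fin; exact: hardy_kernel_ge0.
have mI : measurable (`]0, r[%classic : set RM) by [].
have iW := sqint_sqrt_weight r sb (lexx 0).
have mW : measurable_fun (`]0, r[%classic : set RM) (fun s => beta s ^+ 2 * Num.sqrt s).
  by apply/measurable_EFinP; case/integrableP: iW.
have W0 s : `]0, r[%classic s -> 0 <= beta s ^+ 2 * Num.sqrt s.
  by move=> _; rewrite mulr_ge0 ?sqr_ge0 ?sqrtr_ge0.
have k0 := hardy_weight_ge0 r0.
have -> : (\int[mu]_s (hardy_kernel beta r s)%:E = (hardy_weight r)%:E
    * \int[mu]_(s in `]0%R, r[) (beta s ^+ 2 * Num.sqrt s)%:E)%E.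
  rewrite -(ge0_integral_scale mI mW W0 k0) integral_itv_bndo_bndc; last first.
    by apply/measurable_EFinP; exact: measurable_funM.
  rewrite [RHS]integral_if; apply: eq_integral => s _; rewrite /hardy_kernel.
  have [sr|rs] := leP s r; last first.
    by rewrite memNset//= in_itv /= (leNgt s) rs andbF.
  have [s0|s0] := ltP 0 s.
    by rewrite mem_set /= ?in_itv /= ?s0 ?sr// r0.
  by rewrite memNset /= ?in_itv /= ?(ltNge 0) ?s0// mulr0.
rewrite -(fineK (integrable_fin_num mI iW)).
rewrite -EFinM lee_fin exprMn.
have -> : hardy_weight r = 2 * Num.sqrt r * r^-1 ^+ 2.
  rewrite /hardy_weight; set q := Num.sqrt r.
  have q0 : q != 0 by rewrite gt_eqF// sqrtr_gt0.
  have -> : r = q ^+ 2 by rewrite sqr_sqrtr ?ltW.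
  by field.
rewrite [leRHS]mulrAC ler_wpM2r ?sqr_ge0//.
exact: primitive_sq_le.
Qed.

(** Integrate the bound of [primitive_sq_le] divided by r^2 and exchange the order
    of integration: the square norm of the quotient is at most 4 times that of
    beta. *)
Lemma hardy beta : sqint beta -> sqint (fun r => primitive beta r / r).
Proof.
move=> sb.
have mU : measurable_fun H (fun r => primitive beta r / r).
  apply: open_continuous_measurable_fun; first by rewrite halflineE.
  move=> r; rewrite inE => r0; apply: cvgM; first exact: primitive_continuous.
  by apply: cvgV; [rewrite gt_eqF|exact: cvg_id].
have mU2 : measurable_fun H (fun r => (primitive beta r / r) ^+ 2).
  exact: measurable_funX.
have msq : measurable_fun H (fun s => beta s ^+ 2) by apply: measurable_funX; case: sb.
have m4 : measurable_fun H (fun s => 4 * beta s ^+ 2) by exact: measurable_funM.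
have sq0 s : H s -> 0 <= beta s ^+ 2 by move=> _; exact: sqr_ge0.
have mK := measurable_hardy_kernel sb.
have K0 (z : RM * RM) : (0 <= (hardy_kernel beta z.1 z.2)%:E)%E.
  by rewrite lee_fin; exact: hardy_kernel_ge0.
have FT := @fubini_tonelli _ _ RM RM R mu mu _ mK K0.
have mF := @measurable_fun_fubini_tonelli_F _ _ RM RM R mu _ mK K0.
have mG := @measurable_fun_fubini_tonelli_G _ _ RM RM R mu _ mK K0.
split; first exact: mU.
have upper : (\int[mu]_s \int[mu]_r (hardy_kernel beta r s)%:E <=
    4%:E * \int[mu]_(s in H) (beta s ^+ 2)%:E)%E.
  rewrite -(ge0_integral_scale mH msq sq0 (ler0n R 4)) integral_if.
  apply: ge0_le_integral.
  - exact: measurableT.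
  - by move=> s _; apply: integral_ge0 => r _; exact: (K0 (r, s)).
  - exact: mG.
  - by apply/measurable_EFinP; exact: (measurable_fun_if_set mH m4).
  - by move=> s _; exact: integral_hardy_kernel_l.
have lower : (\int[mu]_(r in H) ((primitive beta r / r) ^+ 2)%:E <=
    \int[mu]_r \int[mu]_s (hardy_kernel beta r s)%:E)%E.
  rewrite integral_if; apply: ge0_le_integral.
  - exact: measurableT.
  - by move=> r _; rewrite lee_fin; case: ifP => _; [exact: sqr_ge0|exact: lexx].
  - by apply/measurable_EFinP; exact: (measurable_fun_if_set mH mU2).
  - exact: mF.
  - by move=> r _; exact: integral_hardy_kernel_r.
apply: (le_lt_trans lower); rewrite FT; apply: (le_lt_trans upper).
by apply: lte_mul_pinfty; [rewrite lee_fin|exact: isT|case: sb].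
Qed.

End Hardy.

(** * Membership in the space J *)

Section JMembership.
Context {R : realType}.
Local Notation mu := (@lebesgue_measure R).
Local Notation H := (@halfline R).
Local Notation RM := (measurableTypeR R).
Local Notation integ A f := (mu.-integrable A (EFin \o f)).
Implicit Types (f g beta : R -> R) (a b c t r x y : R) (u v : R -> R[i]) (z : R[i]).

Let mH := @measurable_halfline R.

(** Lebesgue's differentiation theorem, applied to the restrictions of beta to the
    countably many intervals ]0, n+1]. *)
Lemma primitive_ae_derive beta : sqint beta ->
  {ae mu, forall r, 0 < r -> is_derive r 1 (primitive beta) (beta r)}.
Proof.
move=> sb.
pose I n : set RM := `]0, n.+1%:R]%classic.
have mI n : measurable (I n) by exact: measurable_itv.
have iI n : integ (I n) beta by exact: sqint_integ_oc.
pose f n := beta \_ (I n).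
have iT n : integ setT (f n).
  by move/(integrable_mkcond _ (mI n)) : (iI n); rewrite restrict_EFin.
have lf n : locally_integrable setT (f n) 
  by apply: integrable_locally; [exact: measurable_itv|exact: iI].
have iy n y : integ [set` Interval (BRight 0) (BRight y)] (f n).
  by apply: integ_sub (iT n).
pose F n (y : R) : R := \int[mu]_(s in [set` Interval (BRight 0) (BRight y)]) f n s.
have : {ae mu, forall (r : R) n, (BRight (0 : R) < BRight r)%O ->
    derivable (F n) r 1 /\ derive1 (F n) r = f n r}.
  apply: ae_foralln => n.
  have := FTC1 (iy n) (lf n).
  apply: filterS; first exact: (ae_filter_ringOfSetsType mu).
  by move=> r hr r0; exact: hr.
have FF : Filter (nbhs (almost_everywhere mu)) := ae_filter_ringOfSetsType mu.
apply: filterS => r Hr r0.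
pose n := Num.truncn r.
have rn : r < n.+1%:R by exact: truncnS_gt.
have [|dF F'] := Hr n; first by rewrite bnd_simp.
have fE s : 0 < s -> s <= n.+1%:R -> f n s = beta s.
  by move=> s0 sn; rewrite /f patchE mem_set// /I /= in_itv /= s0.
have fr := fE _ r0 (ltW rn).
rewrite -fr -F'.
apply: (near_eq_is_derive (f := F n)); last first.
  by rewrite derive1E; exact: derivableP.
near=> y.
have yn : y < n.+1%:R by near: y; exact: lt_nbhsl.
rewrite /F /primitive Rintegral_itv_bndo_bndc; last exact: sqint_integ_oo.
apply: eq_Rintegral => s; rewrite inE /= in_itv /= => /andP[s0 sy].
by rewrite fE// (le_trans sy (ltW yn)).
Unshelve. all: by end_near. Qed.

Lemma normc_sq z : normc z ^+ 2 = complex.Re z ^+ 2 + complex.Im z ^+ 2.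
Proof. by case: z => a b /=; rewrite sqr_sqrtr// addr_ge0 ?sqr_ge0. Qed.

(** Passing to squares, the right-hand side has the additional cross term
    2 |Re z| |Im z|. *)
Lemma normc_le z : normc z <= `|complex.Re z| + `|complex.Im z|.
Proof.
rewrite -(@ler_pXn2r _ 2) ?nnegrE ?addr_ge0//; last by case: z => a b; rewrite sqrtr_ge0.
rewrite normc_sq sqrrD !real_normK ?num_real// -addrA lerD2l lerDr.
by rewrite mulrn_wge0// mulr_ge0.
Qed.

Lemma L2P u : L2 u <-> sqint (fun r => complex.Re (u r)) /\ sqint (fun r => complex.Im (u r)).
Proof.
split=> [[mre mim fin]|[sre sim]].
  have mn : measurable_fun H (fun r => complex.Re (u r) ^+ 2 + complex.Im (u r) ^+ 2).
    by apply: measurable_funD; exact: measurable_funX.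
  have {}fin : (\int[mu]_(r in H) (complex.Re (u r) ^+ 2 + complex.Im (u r) ^+ 2)%:E < +oo)%E.
    by apply: le_lt_trans fin; under eq_integral do rewrite -normc_sq.
  split; split=> //; apply: le_lt_trans fin; apply: ge0_le_integral => //.
  - by move=> r _; rewrite lee_fin sqr_ge0.
  - by apply/measurable_EFinP; exact: measurable_funX.
  - exact/measurable_EFinP.
  - by move=> r _; rewrite lee_fin lerDl sqr_ge0.
  - by move=> r _; rewrite lee_fin sqr_ge0.
  - by apply/measurable_EFinP; exact: measurable_funX.
  - exact/measurable_EFinP.
  - by move=> r _; rewrite lee_fin lerDr sqr_ge0.
split; [by case: sre|by case: sim|].
have := integD mH (sqint_integrable sre) (sqint_integrable sim).
move=> /integrableP[_]; apply: le_lt_trans.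
rewrite le_eqVlt; apply/orP; left; apply/eqP; apply: eq_integral => r _.
by rewrite normc_sq /= ger0_norm// addr_ge0 ?sqr_ge0.
Qed.

Lemma sqint_eq f g : (forall r, 0 < r -> f r = g r) -> sqint f -> sqint g.
Proof.
move=> fg sf.
have mg : measurable_fun H g.
  by apply: eq_measurable_fun (sf.1) => r; rewrite inE => /fg.
by apply: (sqint_le mg sf) => r /fg->.
Qed.

Lemma Re_scale a z : complex.Re (a%:C * z) = a * complex.Re z.
Proof. by case: z => b c /=; rewrite mul0r subr0. Qed.

Lemma Im_scale a z : complex.Im (a%:C * z) = a * complex.Im z.
Proof. by case: z => b c /=; rewrite mul0r addr0. Qed.

Lemma Re_divr z r : complex.Re (z / r%:C) = complex.Re z / r.
Proof. by rewrite -fmorphV mulrC Re_scale mulrC. Qed.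

Lemma Im_divr z r : complex.Im (z / r%:C) = complex.Im z / r.
Proof. by rewrite -fmorphV mulrC Im_scale mulrC. Qed.

(** The extension of u by 0 at the origin is the complex primitive itself, since
    primitives vanish at 0; this is what makes u / r square integrable. *)
Lemma Jspace_primitive u (bre bim : R -> R) : sqint bre -> sqint bim ->
  (forall r, 0 < r -> complex.Re (u r) = primitive bre r) ->
  (forall r, 0 < r -> complex.Im (u r) = primitive bim r) ->
  Jspace u.
Proof.
move=> sre sim ure uim; split.
(* The extension of u by 0, as required for absolute continuity on [0, M]. *)
- pose v r := if 0 < r then u r else 0.
  have vre r : 0 <= r -> complex.Re (v r) = primitive bre r.
    rewrite /v le_eqVlt => /predU1P[<-|r0]; first by rewrite ltxx primitive0.
    by rewrite r0 ure.
  have vim r : 0 <= r -> complex.Im (v r) = primitive bim r.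
    rewrite /v le_eqVlt => /predU1P[<-|r0]; first by rewrite ltxx primitive0.
    by rewrite r0 uim.
  exists v; split=> [r r0|M _ eps e0]; first by rewrite /v r0.
  have e20 : 0 < eps / 2 by rewrite divr_gt0.
  have [d1 d10 H1] := primitive_absolutely_continuous sre e20.
  have [d2 d20 H2] := primitive_absolutely_continuous sim e20.
  exists (Num.min d1 d2); first by rewrite lt_min d10.
  move=> n x y xyM tI; rewrite lt_min => /andP[s1 s2].
  have xy i : 0 <= x i <= y i by have [-> [-> _]] := xyM i.
  have x0 i : 0 <= x i by case/andP: (xy i).
  have y0 i : 0 <= y i by case/andP: (xy i) => /le_trans; apply.
  apply: (@le_lt_trans _ _ (\sum_(i < n) `|primitive bre (y i) - primitive bre (x i)| +
     \sum_(i < n) `|primitive bim (y i) - primitive bim (x i)|)).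
    rewrite -big_split; apply: ler_sum => i _; apply: le_trans (normc_le _) _.
    by rewrite !raddfB /= !vre// !vim.
  by rewrite [eps]splitr ltrD ?H1 ?H2.
- apply/L2P; split.
  + apply: sqint_eq (hardy sre) => r r0; rewrite -ure//.
    by rewrite Re_divr.
  + apply: sqint_eq (hardy sim) => r r0; rewrite -uim//.
    by rewrite Im_divr.
- exists (fun r => bre r +i* bim r); first by apply/L2P.
  have := primitive_ae_derive sre; have := primitive_ae_derive sim.
  have FF : Filter (nbhs (almost_everywhere mu)) := ae_filter_ringOfSetsType mu.
  apply: filterS2 => r him hre r0; split=> /=.
    apply: near_eq_is_derive (hre r0); near=> s; rewrite -ure//.
    by near: s; exact: lt_nbhsr.
  apply: near_eq_is_derive (him r0); near=> s; rewrite -uim//.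
  by near: s; exact: lt_nbhsr.
Unshelve. all: by end_near. Qed.

End JMembership.

(** * Weak solutions *)

Section WeakSolutions.
Context {R : realType}.
Local Notation mu := (@lebesgue_measure R).
Local Notation H := (@halfline R).
Local Notation RM := (measurableTypeR R).
Local Notation integ A f := (mu.-integrable A (EFin \o f)).
Implicit Types (phi p q beta : R -> R) (a b c t r x y : R) (u v : R -> R[i]) (z : R[i]).

Let mH := @measurable_halfline R.

Lemma pairing_linear phi p q a b x y : continuous phi -> 0 < a ->
  (forall r, r \notin `[a, b] -> phi r = 0) -> locint p -> locint q ->
  \int[mu]_(r in H) ((x * p r + y * q r) * phi r) =
  x * (\int[mu]_(r in H) (p r * phi r)) + y * (\int[mu]_(r in H) (q r * phi r)).
Proof.
move=> cphi a0 out lp lq.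
have iphi w : locint w -> integ H (fun r => w r * phi r).
  move=> lw; apply: (integ_support a0 (b := b)).
    by move=> r /out ->; rewrite mulr0.
  rewrite (_ : (fun r => _) = fun r => phi r * w r).
    by apply: locintM => // r _; exact: cphi.
  by apply/funext => r; rewrite mulrC.
rewrite -!RintegralZl ?iphi// -RintegralD//; try by apply: integZ => //; exact: iphi.
by apply: eq_Rintegral => r _; ring.
Qed.

Lemma rsmooth_continuous phi : rsmooth phi -> continuous phi.
Proof. by move=> sphi r; apply/differentiable_continuous/derivable1_diffP/(sphi 0%N). Qed.

Lemma rsmooth_derive1 phi : rsmooth phi -> rsmooth (derive1 phi).
Proof. by move=> sphi n r; rewrite -derive1Sn; exact: sphi. Qed.

Lemma rsmooth0 : rsmooth (fun=> 0 : R).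
Proof.
apply: (rsmooth_coind (P := fun g => g = cst 0)) => // g ->; split.
  by move=> r; exact: derivable_cst.
by apply/funext => r; rewrite derive1_cst.
Qed.

Lemma derive1_support phi a b : (forall r, r \notin `[a, b] -> phi r = 0) ->
  forall r, r \notin `[a, b] -> derive1 phi r = 0.
Proof.
move=> out r; rewrite in_itv /= negb_and -!ltNge => rab.
apply: is_derive_derive1.
suff rout : \forall s \near r, 0 = phi s.
  exact: (near_eq_is_derive (f := cst 0) rout).
case/orP: rab => [ra|br]; near=> s; rewrite out// in_itv /= negb_and -!ltNge.
  by apply/orP; left; near: s; exact: lt_nbhsl.
by apply/orP; right; near: s; exact: lt_nbhsr.
Unshelve. all: by end_near. Qed.

(** The closed interval [a, b] contains the closure of the support, is compact and
    misses 0. *)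
Lemma test_function_real phi a b : rsmooth phi -> 0 < a ->
  (forall r, r \notin `[a, b] -> phi r = 0) -> test_function (fun r => (phi r)%:C).
Proof.
move=> sphi a0 out.
have sub : closure [set r | (phi r)%:C != 0] `<=` `[a, b]%classic.
  have cl : closed `[a, b]%classic.
    exact: (compact_closed (@norm_hausdorff _ R) (@segment_compact R a b)).
  rewrite [X in _ `<=` X]((closure_id _).1 cl); apply: closure_subset => r /=.
  by apply: contraNP => /negP/out ->; rewrite eqxx.
split.
- by move=> n r; split; [exact: sphi|exact: rsmooth0].
- apply: (subclosed_compact _ (@segment_compact R a b) sub).
  exact: closed_closure.
- exact: subset_trans sub (itv_cc_halfline a0).
Qed.

(** Both real-linear coordinates of the complex plane commute with all operations
    of the equations, whose coefficients are real; P stands for either of them. *)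
Definition is_part (P : R[i] -> R) : Prop :=
  P = (fun z => complex.Re z) \/ P = (fun z => complex.Im z).

Lemma partD P : is_part P -> forall z w, P (z + w) = P z + P w.
Proof. by move=> [->|->] [? ?] [? ?]. Qed.

Lemma partN P : is_part P -> forall z, P (- z) = - P z.
Proof. by move=> [->|->] [? ?]. Qed.

Lemma part_scale P : is_part P -> forall a z, P (a%:C * z) = a * P z.
Proof. by move=> [->|->] a z; [exact: Re_scale|exact: Im_scale]. Qed.

Lemma part_le P : is_part P -> forall z, `|P z| <= normc z.
Proof.
move=> hP z; rewrite -(@ler_pXn2r _ 2) ?nnegrE//; last by case: z => a b; rewrite sqrtr_ge0.
rewrite normc_sq real_normK ?num_real//.
by case: hP => ->; [rewrite lerDl sqr_ge0|rewrite lerDr sqr_ge0].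
Qed.

Lemma part_dpairing P : is_part P -> forall u (phi : R -> R),
  P (dpairing u (fun r => (phi r)%:C)) = \int[mu]_(r in H) (P (u r) * phi r).
Proof.
move=> [->|->] u phi /=; apply: eq_Rintegral => r _; rewrite mulrC.
  by rewrite Re_scale mulrC.
by rewrite Im_scale mulrC.
Qed.

Lemma part_dpairing_deriv P : is_part P -> forall u (phi : R -> R),
  P (dpairing_deriv u (fun r => (phi r)%:C)) =
  - \int[mu]_(r in H) (P (u r) * derive1 phi r).
Proof.
move=> hP u phi; rewrite /dpairing_deriv partN// -part_dpairing//.
congr (- P (dpairing _ _)); apply/funext => r; rewrite /cderive /=.
by congr (_ +i* _); rewrite derive1_cst.
Qed.

Lemma part_sqint P u : is_part P -> L2 u -> sqint (fun r => P (u r)).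
Proof. by move=> [->|->] /L2P[]. Qed.

Lemma part_continuous P u : is_part P -> (forall r, 0 < r -> ccontinuous_at u r) ->
  forall r, 0 < r -> {for r, continuous (fun s => P (u s))}.
Proof. by move=> [->|->] cu r /cu[]. Qed.

Lemma continuous_affine_inv a b r : 0 < r -> {for r, continuous (fun t : R => a + b / t)}.
Proof.
move=> r0; apply: cvgD; first exact: cvg_cst.
by apply: cvgMl_tmp; apply: cvgV; [rewrite gt_eqF|exact: cvg_id].
Qed.

(** The two hypotheses on (c1, c2) say that this row vector annihilates M.  In the
    combination of the two weak equations with coefficients c1 and c2, the terms
    in 1 / r cancel and only the L^2 part c b of the derivative remains. *)
Lemma hstar_weak_derivative (m nu mu' lam : R) (k : int) (f g : (R -> R[i]) * (R -> R[i]))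
    (c1 c2 : R) P : is_part P ->
  c1 * (k%:~R + lam) = c2 * (nu + mu') -> c1 * (nu - mu') = c2 * (k%:~R + lam) ->
  hstar_graph m nu mu' lam k f g ->
  weak_derivative (fun r => c1 * P (f.1 r) + c2 * P (f.2 r))
    (fun r => c1 * (P (g.2 r) + m * P (f.2 r)) + c2 * (m * P (f.1 r) - P (g.1 r))).
Proof.
move=> hP e1 e2 [cf [L2f1 L2f2] [L2g1 L2g2] wf] phi a b sphi a0 out.
have [eq1 eq2] := wf _ (test_function_real sphi a0 out).
move: eq1 => /(congr1 P); move: eq2 => /(congr1 P).
rewrite !(partD hP) (part_dpairing_deriv hP) (partN hP) (part_dpairing_deriv hP).
rewrite !(part_dpairing hP).
set kap := k%:~R + lam in e1 e2 *.
have cphi := rsmooth_continuous sphi.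
have cphi' := rsmooth_continuous (rsmooth_derive1 sphi).
have lf1 : locint (fun r => P (f.1 r)) by apply: sqint_locint; exact: part_sqint.
have lf2 : locint (fun r => P (f.2 r)) by apply: sqint_locint; exact: part_sqint.
have lg1 : locint (fun r => P (g.1 r)) by apply: sqint_locint; exact: part_sqint.
have lg2 : locint (fun r => P (g.2 r)) by apply: sqint_locint; exact: part_sqint.
have lw w c d : locint w -> locint (fun r => (c + d / r) * w r).
  by move=> lw; apply: locintM => // r r0; exact: continuous_affine_inv.
have lw0 w d : locint w -> locint (fun r => d / r * w r).
  move=> /(lw _ 0 d); rewrite (_ : (fun r => _) = fun r => d / r * w r)//.
  by apply/funext => r; rewrite add0r.
pose L p := \int[mu]_(r in H) (p r * phi r).
have Llin p q x y : locint p -> locint q ->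
    L (fun r => x * p r + y * q r) = x * L p + y * L q.
  by move=> lp lq; exact: (pairing_linear x y cphi a0 out lp lq).
pose a1 r := (m + (nu + mu') / r) * P (f.1 r).
pose b2 r := kap / r * P (f.2 r).
pose a3 r := kap / r * P (f.1 r).
pose a4 r := (- m + (nu - mu') / r) * P (f.2 r).
have -> : \int[mu]_(r in H) (P (((k%:~R + lam) / r)%:C * f.1 r) * phi r) = L a3.
  by apply: eq_Rintegral => r _; rewrite part_scale.
have -> : \int[mu]_(r in H) (P (((k%:~R + lam) / r)%:C * f.2 r) * phi r) = L b2.
  by apply: eq_Rintegral => r _; rewrite part_scale.
have -> : \int[mu]_(r in H) (P ((- m + (nu - mu') / r)%:C * f.2 r) * phi r) = L a4.
  by apply: eq_Rintegral => r _; rewrite part_scale.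
have -> : \int[mu]_(r in H) (P ((m + (nu + mu') / r)%:C * f.1 r) * phi r) = L a1.
  by apply: eq_Rintegral => r _; rewrite part_scale.
rewrite -/(L (fun r => P (g.1 r))) -/(L (fun r => P (g.2 r))).
have la1 : locint a1 by exact: lw.
have lb2 : locint b2 by exact: lw0.
have la3 : locint a3 by exact: lw0.
have la4 : locint a4 by exact: lw.
have lD x y p q : locint p -> locint q -> locint (fun r => x * p r + y * q r).
  by move=> lp lq; apply: locintD; exact: locintZ.
rewrite (pairing_linear c1 c2 cphi' a0 (derive1_support out) lf1 lf2).
(* The derivative is written as nested binary combinations, to which linearity
   of the pairing applies. *)
pose p1 r := c1 * a3 r + c1 * a4 r.
pose p2 r := (- c1) * P (g.2 r) + c2 * P (g.1 r).
pose p3 r := (- c2) * a1 r + (- c2) * b2 r.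
pose p4 r := 1 * p1 r + 1 * p2 r.
pose p5 r := (-1) * p4 r + (-1) * p3 r.
have -> : \int[mu]_(r in H) ((c1 * (P (g.2 r) + m * P (f.2 r)) +
    c2 * (m * P (f.1 r) - P (g.1 r))) * phi r) = L p5.
  apply: eq_Rintegral => r; rewrite inE => r0; congr (_ * _).
  have r_neq0 : r != 0 by rewrite gt_eqF.
  rewrite /p5 /p4 /p3 /p2 /p1 /a1 /b2 /a3 /a4.
  have E1 : c1 * (kap / r * P (f.1 r)) = c2 * (nu + mu') / r * P (f.1 r).
    by rewrite -e1; ring.
  have E2 : c2 * (kap / r * P (f.2 r)) = c1 * (nu - mu') / r * P (f.2 r).
    by rewrite e2; ring.
  by rewrite E1 [- c2 * (kap / r * _)]mulNr E2; ring.
have lp1 : locint p1 by exact: lD.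
have lp2 : locint p2 by exact: lD.
have lp3 : locint p3 by exact: lD.
have lp4 : locint p4 by exact: lD.
rewrite (Llin p4 p3)// (Llin p1 p2)// (Llin a3 a4)// (Llin a1 b2)//.
rewrite (Llin (fun r => P (g.2 r)) (fun r => P (g.1 r)))//.
set D1 := \int[mu]_(r in H) (P (f.1 r) * _); set D2 := \int[mu]_(r in H) (P (f.2 r) * _).
move=> eq2 eq1.
have -> : D1 = L a3 + L a4 - L (fun r => P (g.2 r)) by rewrite -eq2; ring.
have -> : D2 = L (fun r => P (g.1 r)) - L a1 - L b2 by rewrite -eq1; ring.
by ring.
Qed.

(** Both functions have the same increments, and both tend to 0 at the origin. *)
Lemma weak_derivative_primitive (w beta : R -> R) :
  (forall r, 0 < r -> {for r, continuous w}) -> sqint beta ->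
  weak_derivative w beta -> w r @[r --> 0^'+] --> 0 ->
  forall r, 0 < r -> w r = primitive beta r.
Proof.
move=> cw sb wd w0 r r0.
apply/eqP; rewrite -subr_eq0; apply/eqP.
have cst x : 0 < x -> x < r -> w r - primitive beta r = w x - primitive beta x.
  move=> x0 xr.
  have := weak_derivative_increment cw (sqint_locint sb) wd x0 xr.
  rewrite -Rintegral_itv_bndo_bndc; last by apply: sqint_integ_oo => //; exact: ltW.
  by rewrite -primitive_increment ?ltW// => E; lra.
have lim : (w x - primitive beta x) @[x --> 0^'+] --> (0 : R).
  rewrite -[X in _ --> X](subr0 0); apply: cvgB => //.
  apply/cvgrPdist_lt => e e0.
  have [d d0 Hd] := primitive_uniformly_continuous sb e0.
  near=> x; have x0 : 0 < x by near: x; exact: nbhs_right_gt.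
  have := Hd 0 x (lexx _) (ltW x0).
  rewrite primitive0 subr0 sub0r normrN subr0 gtr0_norm//; apply.
  by near: x; exact: nbhs_right_lt.
have lim' : (w x - primitive beta x) @[x --> 0^'+] --> w r - primitive beta r.
  apply: cvg_near_cst; near=> x; apply/esym/cst.
    by near: x; exact: nbhs_right_gt.
  by near: x; exact: nbhs_right_lt.
exact: (cvg_unique (@norm_hausdorff _ _) lim' lim).
Unshelve. all: by end_near. Qed.

End WeakSolutions.

(** * The boundary angle is sufficient *)

Section Sufficiency.
Context {R : realType}.
Implicit Types (a b c t r x y : R) (u v : R -> R[i]) (z : R[i]).

Definition residual (nu mu lam : R) (k : int) (f1 f2 Ap Am : R[i]) r : 'cV[R[i]]_2 :=
  col2 f1 f2 - ((ln r)%:C *: Mmx nu mu lam k + 1%:M) *m col2 Ap Am.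

Lemma residual_entries (nu mu lam : R) (k : int) (f1 f2 Ap Am : R[i]) r :
  residual nu mu lam k f1 f2 Ap Am r ord0 ord0 =
    f1 - (Ap + (ln r)%:C * ((- (k%:~R + lam))%:C * Ap + (- nu + mu)%:C * Am)) /\
  residual nu mu lam k f1 f2 Ap Am r ord_max ord0 =
    f2 - (Am + (ln r)%:C * ((nu + mu)%:C * Ap + (k%:~R + lam)%:C * Am)).
Proof.
rewrite /residual /Mmx /mx22 /col2.
by split; rewrite !mxE !big_ord_recl big_ord0 !mxE /= ?mulr1n ?mulr0n; ring.
Qed.

Lemma norm_C2E (v : 'cV[R[i]]_2) :
  norm_C2 v = Num.sqrt (normc (v ord0 ord0) ^+ 2 + normc (v ord_max ord0) ^+ 2).
Proof.
rewrite /norm_C2 !big_ord_recl big_ord0 addr0.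
by congr (Num.sqrt (_ + normc (v _ _) ^+ 2)); apply/val_inj.
Qed.

Lemma normc_ge0 z : 0 <= normc z.
Proof. by case: z => a b; rewrite sqrtr_ge0. Qed.

Lemma normc_le_norm_C2 (v : 'cV[R[i]]_2) :
  normc (v ord0 ord0) <= norm_C2 v /\ normc (v ord_max ord0) <= norm_C2 v.
Proof.
by rewrite norm_C2E; split; rewrite -[leLHS](ger0_norm (normc_ge0 _)) -sqrtr_sqr ler_wsqrtr//
  ?lerDl ?lerDr sqr_ge0.
Qed.

(** Since c M = 0, the row c maps the leading term (M log r + 1) A to c A = 0, so
    c f is c applied to the residual, which is o(sqrt r). *)
Lemma boundary_limit (nu mu lam : R) (k : int) (f : (R -> R[i]) * (R -> R[i]))
    (Ap Am : R[i]) (c1 c2 : R) P : is_part P ->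
  c1 * (k%:~R + lam) = c2 * (nu + mu) -> c1 * (nu - mu) = c2 * (k%:~R + lam) ->
  norm_C2 (residual nu mu lam k (f.1 r) (f.2 r) Ap Am r) * r `^ (- 2^-1)
    @[r --> 0^'+] --> (0 : R) ->
  c1%:C * Ap + c2%:C * Am = 0 ->
  c1 * P (f.1 r) + c2 * P (f.2 r) @[r --> 0^'+] --> 0.
Proof.
move=> hP e1 e2 lim A0.
set kap := k%:~R + lam in e1 e2.
pose N r := norm_C2 (residual nu mu lam k (f.1 r) (f.2 r) Ap Am r).
apply: norm_cvg0.
apply: (@squeeze_cvgr _ _ _ _ (cst 0)
  (fun r => (`|c1| + `|c2|) * (N r * r `^ (- 2^-1)))); last 2 first.
- exact: cvg_cst.
- by rewrite -[X in _ --> X](mulr0 (`|c1| + `|c2|)); exact: cvgMl_tmp lim.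
near=> r; rewrite normr_ge0 /=.
have r0 : 0 < r by near: r; exact: nbhs_right_gt.
have r1 : r <= 1 by near: r; exact: nbhs_right_ltW.
have N0 : 0 <= N r by rewrite /N sqrtr_ge0.
(* For r <= 1 the factor r^(- 1/2) only enlarges the residual. *)
have NP : N r <= N r * r `^ (- 2^-1).
  rewrite ler_peMr// powRN invf_ge1 ?powR_gt0//.
  by rewrite (powR12_sqrt (ltW r0)) -sqrtr1 ler_wsqrtr.
have [v1E v2E] := residual_entries nu mu lam k (f.1 r) (f.2 r) Ap Am r.
have [n1 n2] := normc_le_norm_C2 (residual nu mu lam k (f.1 r) (f.2 r) Ap Am r).
set v1 := residual _ _ _ _ _ _ _ _ _ _ _ in v1E n1.
set v2 := residual _ _ _ _ _ _ _ _ _ _ _ in v2E n2.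
have E : c1%:C * f.1 r + c2%:C * f.2 r = c1%:C * v1 + c2%:C * v2.
  have E1 : c1%:C * kap%:C = c2%:C * (nu + mu)%:C by rewrite -!rmorphM /= e1.
  have E2 : c1%:C * (- nu + mu)%:C = - (c2%:C * kap%:C).
    by rewrite -!rmorphM -rmorphN /= -e2; congr (_%:C); ring.
  rewrite v1E v2E -/kap rmorphN /=.
  have -> : c1%:C * (f.1 r - (Ap + (ln r)%:C * (- kap%:C * Ap + (- nu + mu)%:C * Am))) +
    c2%:C * (f.2 r - (Am + (ln r)%:C * ((nu + mu)%:C * Ap + kap%:C * Am))) =
    c1%:C * f.1 r + c2%:C * f.2 r - (c1%:C * Ap + c2%:C * Am)
    + (ln r)%:C * ((c1%:C * kap%:C - c2%:C * (nu + mu)%:C) * Ap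
      - (c1%:C * (- nu + mu)%:C + c2%:C * kap%:C) * Am) by ring.
  by rewrite A0 E1 E2; ring.
have -> : c1 * P (f.1 r) + c2 * P (f.2 r) = c1 * P v1 + c2 * P v2.
  by rewrite -!(part_scale hP) -!(partD hP) E.
apply: (@le_trans _ _ ((`|c1| + `|c2|) * N r)); last by rewrite ler_wpM2l// addr_ge0.
apply: (le_trans (ler_normD _ _)); rewrite !normrM mulrDl lerD// ler_wpM2l//.
  exact: le_trans (part_le hP _) n1.
exact: le_trans (part_le hP _) n2.
Unshelve. all: by end_near. Qed.

(** By [hstar_weak_derivative] and [boundary_limit], both parts of c f are the
    primitives of the L^2 function c b that start from 0. *)
Lemma t_domain_Jspace (m nu mu lam : R) (k : int) (theta : R)
    (f : (R -> R[i]) * (R -> R[i])) (c1 c2 : R) :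
  c1 * (k%:~R + lam) = c2 * (nu + mu) -> c1 * (nu - mu) = c2 * (k%:~R + lam) ->
  (forall Ap Am : R[i], Ap * (sin theta)%:C + Am * (cos theta)%:C = 0 ->
    c1%:C * Ap + c2%:C * Am = 0) ->
  t_domain m nu mu lam k theta f ->
  Jspace (fun r => c1%:C * f.1 r + c2%:C * f.2 r).
Proof.
move=> e1 e2 hA [g [hg [Ap [Am [/hA A0 lim]]]]].
pose beta (P : R[i] -> R) r :=
  c1 * (P (g.2 r) + m * P (f.2 r)) + c2 * (m * P (f.1 r) - P (g.1 r)).
have [cf [L2f1 L2f2] [L2g1 L2g2] _] := hg.
have sb P : is_part P -> sqint (beta P).
  move=> hP; have s w : L2 w -> sqint (fun r => P (w r)) by exact: part_sqint.
  apply: sqintD; apply: sqintZ; apply: sqintD; try exact: sqintZ (s _ _).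
  - exact: s.
  - apply: (@sqint_eq _ (fun r => -1 * P (g.1 r))) => [r _|]; first by rewrite mulN1r.
    exact: sqintZ (s _ _).
have prim P : is_part P -> forall r, 0 < r ->
    c1 * P (f.1 r) + c2 * P (f.2 r) = primitive (beta P) r.
  move=> hP; apply: weak_derivative_primitive.
  - move=> r r0; apply: cvgD; apply: cvgMl_tmp; apply: part_continuous => // s s0.
      by case: (cf s s0).
    by case: (cf s s0).
  - exact: sb.
  - exact: hstar_weak_derivative hg.
  - exact: boundary_limit lim A0.
have hre : is_part (fun z : R[i] => complex.Re z) by left.
have him : is_part (fun z : R[i] => complex.Im z) by right.
apply: (Jspace_primitive (sb _ hre) (sb _ him)) => r r0.
  by rewrite -prim// (partD hre) !(part_scale hre).
by rewrite -prim// (partD him) !(part_scale him).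
Qed.

End Sufficiency.

(** * Explicit solutions *)

Section Example.
Context {R : realType}.
Local Notation mu := (@lebesgue_measure R).
Local Notation H := (@halfline R).
Local Notation RM := (measurableTypeR R).
Local Notation integ A f := (mu.-integrable A (EFin \o f)).
Implicit Types (phi p q : R -> R) (a b c t r x y : R) (u v : R -> R[i]) (z : R[i]).

Let mH := @measurable_halfline R.

(** The product with a test function vanishes at both ends of a slightly larger
    interval; integrate its derivative. *)
Lemma C1_weak_derivative p p' : (forall r, 0 < r -> is_derive r 1 p (p' r)) ->
  (forall r, 0 < r -> {for r, continuous p'}) -> weak_derivative p p'.
Proof.
move=> dp cp' phi a b sphi a0 out.
(* A strictly larger interval: phi vanishes at its end points without any
   appeal to continuity. *)
pose a' := a / 2; pose b' := Num.max a b + 1.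
have a'0 : 0 < a' by rewrite divr_gt0.
have a'a : a' < a by rewrite /a'; lra.
have ab : a <= Num.max a b by rewrite le_max lexx.
have bb : b <= Num.max a b by rewrite le_max lexx orbT.
have bb' : b < b' by rewrite /b'; lra.
have a'b' : a' < b' by rewrite /b'; lra.
have out' r : r \notin `[a', b'] -> phi r = 0.
  rewrite in_itv /= negb_and -!ltNge => /orP[ra|br]; apply: out;
    rewrite in_itv /= negb_and -!ltNge; apply/orP; [left|right]; lra.
have phia : phi a' = 0 by apply: out; rewrite in_itv /= leNgt a'a.
have phib : phi b' = 0 by apply: out; rewrite in_itv /= negb_and -!ltNge bb' orbT.
have cphi := rsmooth_continuous sphi.
have cphi' := rsmooth_continuous (rsmooth_derive1 sphi).
have cp r : 0 < r -> {for r, continuous p} by move=> /dp; exact: is_derive_continuous.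
have lp := continuous_locint cp; have lp' := continuous_locint cp'.
have lphi : locint phi by apply: continuous_locint => r _; exact: cphi.
have lphi' : locint (derive1 phi) by apply: continuous_locint => r _; exact: cphi'.
have out1 r : r \notin `[a', b'] -> p r * derive1 phi r = 0.
  by move=> /(derive1_support out') ->; rewrite mulr0.
have out2 r : r \notin `[a', b'] -> p' r * phi r = 0 by move=> /out' ->; rewrite mulr0.
rewrite (Rintegral_support a'0 out1) (Rintegral_support a'0 out2).
apply/eqP; rewrite -addr_eq0; apply/eqP.
have mI : measurable (`[a', b']%classic : set RM) by exact: measurable_itv.
rewrite -RintegralD//; [|exact: locintM|exact: locintM].
have dF r : a' <= r <= b' ->
    is_derive r 1 (fun s => p s * phi s) (p r * derive1 phi r + p' r * phi r).
  move=> /andP[ar _].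
  have d1 := dp r (lt_le_trans a'0 ar).
  have d2 : is_derive r 1 phi (derive1 phi r).
    by rewrite derive1E; apply: derivableP; exact: (sphi 0%N).
  have := is_deriveM d1 d2; rewrite /GRing.scale /=.
  by rewrite [phi r * p' r]mulrC.
have cF r : a' <= r <= b' ->
    {for r, continuous (fun s => p s * derive1 phi s + p' s * phi s)}.
  move=> /andP[ar _]; have r0 := lt_le_trans a'0 ar.
  by apply: cvgD; apply: cvgM; [exact: cp|exact: cphi'|exact: cp'|exact: cphi].
by rewrite (Rintegral_is_derive a'b' dF cF) phia phib !mulr0 subrr.
Qed.

(** The support is a compact set that misses 0, hence a whole neighbourhood of 0. *)
Lemma test_function_part P u : is_part P -> test_function u ->
  rsmooth (fun r => P (u r)) /\
  exists a b, 0 < a /\ forall r, r \notin `[a, b] -> P (u r) = 0.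
Proof.
move=> hP [su cK KH]; split.
  by move=> n r; case: hP => ->; case: (su n r).
set K := closure _ in cK KH.
have [M [_ HM]] := compact_bounded cK.
have nK0 : nbhs (0 : R) (~` K).
  apply: open_nbhs_nbhs; split.
    by apply: closed_openC; exact: closed_closure.
  by move=> /KH; rewrite /halfline /= ltxx.
have [d /= d0 Hd] := nK0.
exists d, (`|M| + 1); split=> // r.
apply: contraNeq => Pr.
have rK : K r.
  apply: subset_closure => /=; apply: contra_neq Pr => ->.
  by case: hP => ->.
have r0 : 0 < r := KH _ rK.
have M1 : M < `|M| + 1 by rewrite (le_lt_trans (ler_norm _))// ltrDl.
rewrite in_itv /=; apply/andP; split; last first.
  by have := HM _ M1 _ rK; apply: le_trans; exact: ler_norm.
rewrite leNgt; apply/negP => rd; apply: (Hd r) => //=.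
by rewrite sub0r normrN gtr0_norm.
Qed.

(** The components of exp(- r) (M log r + 1) A have this form, with B the
    corresponding component of M A.  The factor exp(- r) ensures decay at infinity
    and changes the function only by O(r (1 + |log r|)) near 0. *)
Definition log_profile (A B : R) r : R := expR (- r) * (A + B * ln r).

Lemma log_profile_derive (A B : R) r : 0 < r ->
  is_derive r 1 (log_profile A B) (expR (- r) * (B / r) - log_profile A B r).
Proof.
move=> r0; have dl := is_derive1_ln r0.
have d1 : is_derive r 1 (fun s : R => expR (- s)) (- expR (- r)).
  have d : is_derive r 1 (fun s : R => - s) (- 1) by exact: is_deriveN.
  by have := is_derive1_comp (g := fun s : R => - s) (is_derive_expR (- r)) d;
     rewrite mulrN1.
have d2 : is_derive r 1 (fun s => A + B * ln s) (B / r).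
  have d : is_derive r 1 (fun s => B * ln s) (B * r^-1) by exact: is_deriveZ.
  have := is_deriveD (is_derive_cst A r 1) d; rewrite add0r.
  by [].
have := is_deriveM d1 d2; rewrite /GRing.scale /=.
by rewrite /log_profile mulrN [(A + _) * _]mulrC.
Qed.

Lemma log_profile_continuous (A B : R) r : 0 < r -> {for r, continuous (log_profile A B)}.
Proof. by move=> /(log_profile_derive A B); exact: is_derive_continuous. Qed.

Lemma ln_sqr_le x : 0 < x -> ln x ^+ 2 <= x ^+ 2 + x ^- 2.
Proof.
move=> x0; have h1 := ln_sublinear x0.
have xV0 : 0 < x^-1 by rewrite invr_gt0.
have h2 : - ln x < x^-1 by rewrite -lnV ?posrE//; exact: ln_sublinear.
rewrite -exprVn; set y := x^-1 in xV0 h2 *; set l := ln x in h1 h2 *.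
have [l0|l0] := leP 0 l; rewrite !expr2; nra.
Qed.

Lemma fourth_root r (w := Num.sqrt (Num.sqrt r)) : 0 < r ->
  [/\ 0 < w, Num.sqrt r = w ^+ 2, r = w ^+ 4 & ln r = 4 * ln w].
Proof.
move=> r0.
have w0 : 0 < w by rewrite !sqrtr_gt0.
have qE : Num.sqrt r = w ^+ 2 by rewrite sqr_sqrtr ?sqrtr_ge0.
have rE : r = w ^+ 4.
  by rewrite -[LHS](sqr_sqrtr (ltW r0)) qE -exprM.
have lE : ln r = 4 * ln w by rewrite [in LHS]rE lnXn// mulr_natl.
by split.
Qed.

(** Up to a factor, |log r| is at most r^(1/4) + r^(- 1/4), and the exponential absorbs
    (1 + r)^2.  The majorant is the derivative of a multiple of 2 atan (sqrt r). *)
Lemma log_profile_sq_le (A B : R) r : 0 < r ->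
  log_profile A B r ^+ 2 <= (2 * A ^+ 2 + 32 * B ^+ 2) * (Num.sqrt r * (1 + r))^-1.
Proof.
move=> r0; have [] := fourth_root r0; set w := Num.sqrt (Num.sqrt r).
move=> w0 qE rE lE.
rewrite qE ler_pdivlMr; last by rewrite mulr_gt0 ?exprn_gt0// addr_gt0.
have lw : ln w ^+ 2 * w ^+ 2 <= 1 + r.
  have := ln_sqr_le w0; rewrite -(ler_pM2r (exprn_gt0 2 w0)) => /le_trans; apply.
  rewrite mulrDl mulVf ?expf_neq0 ?gt_eqF// -exprD rE addrC lexx//.
have w1 : w ^+ 2 <= 1 + r.
  by rewrite rE; have := sqr_ge0 (w ^+ 2 - 1); rewrite !expr2 !exprS expr0; nra.
have AB : (A + B * ln r) ^+ 2 * w ^+ 2 <= (2 * A ^+ 2 + 32 * B ^+ 2) * (1 + r).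
  have h1 : (A + B * ln r) ^+ 2 <= 2 * A ^+ 2 + 32 * (B ^+ 2 * ln w ^+ 2).
    by rewrite lE; have := sqr_ge0 (A - B * (4 * ln w)); rewrite !expr2; nra.
  have h2 : (A + B * ln r) ^+ 2 * w ^+ 2 <=
     (2 * A ^+ 2 + 32 * (B ^+ 2 * ln w ^+ 2)) * w ^+ 2.
    by rewrite ler_wpM2r// sqr_ge0.
  apply: (le_trans h2); rewrite mulrDl [leRHS]mulrDl; apply: lerD.
    by rewrite ler_wpM2l// mulr_ge0// sqr_ge0.
  have -> : 32 * (B ^+ 2 * ln w ^+ 2) * w ^+ 2 = 32 * B ^+ 2 * (ln w ^+ 2 * w ^+ 2) by ring.
  by apply: ler_wpM2l => //; apply: mulr_ge0 => //; exact: sqr_ge0.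
have e1 : expR (- r) * (1 + r) <= 1.
  by rewrite expRN ler_pdivrMl ?expR_gt0// mulr1; exact: expR_ge1Dx.
have e0 : 0 <= expR (- r) * (1 + r) by rewrite mulr_ge0 ?expR_ge0// addr_ge0 ?(ltW r0).
rewrite /log_profile exprMn.
have -> : expR (- r) ^+ 2 * (A + B * ln r) ^+ 2 * (w ^+ 2 * (1 + r)) =
  ((A + B * ln r) ^+ 2 * w ^+ 2) * (expR (- r) ^+ 2 * (1 + r)) by ring.
apply: (@le_trans _ _ ((2 * A ^+ 2 + 32 * B ^+ 2) * (1 + r) * (expR (- r) ^+ 2 * (1 + r)))).
  by rewrite ler_wpM2r// mulr_ge0 ?sqr_ge0// addr_ge0 ?(ltW r0).
have -> : (2 * A ^+ 2 + 32 * B ^+ 2) * (1 + r) * (expR (- r) ^+ 2 * (1 + r)) =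
  (2 * A ^+ 2 + 32 * B ^+ 2) * (expR (- r) * (1 + r)) ^+ 2 by ring.
apply: ler_piMr; first by rewrite addr_ge0// mulr_ge0// sqr_ge0.
by rewrite exprn_ile1.
Qed.

(** Compare with the derivative of the bounded function 2 atan (sqrt r), by
    [log_profile_sq_le]. *)
Lemma log_profile_sqint (A B : R) : sqint (log_profile A B).
Proof.
have mp : measurable_fun H (log_profile A B).
  apply: open_continuous_measurable_fun; first by rewrite halflineE.
  by move=> r; rewrite inE => r0; exact: log_profile_continuous.
split=> //.
pose C := 2 * A ^+ 2 + 32 * B ^+ 2.
have C0 : 0 <= C by rewrite addr_ge0// mulr_ge0// sqr_ge0.
pose G r := C * (2 * atan (Num.sqrt r)).
pose g r := C * (Num.sqrt r * (1 + r))^-1.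
have dG r : 0 < r -> is_derive r 1 G (g r).
  move=> r0; have q0 : Num.sqrt r != 0 by rewrite gt_eqF// sqrtr_gt0.
  have d := is_derive1_comp (is_derive1_atan (Num.sqrt r)) (is_derive1_sqrt r0).
  have -> : g r = C * (2 * ((1 + Num.sqrt r ^+ 2)^-1 * (2 * Num.sqrt r)^-1)).
    have r1 : 1 + r != 0 by rewrite gt_eqF// addr_gt0.
    by rewrite /g sqr_sqrtr ?(ltW r0)//; field; rewrite q0 r1.
  exact: is_deriveZ (is_deriveZ 2 d).
have cg r : 0 < r -> {for r, continuous g}.
  move=> r0; apply: cvgMl_tmp; apply: cvgV.
    by rewrite gt_eqF// mulr_gt0 ?sqrtr_gt0// addr_gt0.
  by apply: cvgM; [exact: sqrt_continuous|apply: cvgD; [exact: cvg_cst|exact: cvg_id]].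
apply: (@le_lt_trans _ _ (C * (2 * pi))%:E); last by rewrite ltry.
apply: exhaustion_integral_le => //.
- exact: measurable_funX.
- by move=> r _; exact: sqr_ge0.
move=> a b a0 ab.
have -> : H `&` `[a, b]%classic = `[a, b]%classic.
  by apply/setIidr; exact: itv_cc_halfline.
have dG' r : a <= r <= b -> is_derive r 1 G (g r).
  by move=> /andP[ar _]; apply: dG; exact: lt_le_trans ar.
have cg' r : a <= r <= b -> {for r, continuous g}.
  by move=> /andP[ar _]; apply: cg; exact: lt_le_trans ar.
have mI : measurable (`[a, b]%classic : set RM) by exact: measurable_itv.
have IH := itv_cc_halfline a0.
apply: (@le_trans _ _ (\int[mu]_(r in `[a, b]) (g r)%:E)%E).
  apply: ge0_le_integral => //.
  - by move=> r _; rewrite lee_fin sqr_ge0.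
  - apply/measurable_EFinP; apply: measurable_funX; exact: measurable_funS mp.
  - apply/measurable_EFinP; apply: subspace_continuous_measurable_fun => //.
    by apply: continuous_in_subspaceT => r; rewrite inE => /IH; exact: cg.
  - by move=> r /IH r0; rewrite lee_fin; exact: log_profile_sq_le.
rewrite (integral_is_derive ab dG' cg') lee_fin /G -mulrBr ler_wpM2l//.
have := atan_ltpi2 (Num.sqrt b); have := atan_gtNpi2 (Num.sqrt a).
by move: (@pi R) => p; lra.
Qed.

End Example.

(** * The boundary angle is necessary *)

Section Necessity.
Context {R : realType}.
Local Notation mu := (@lebesgue_measure R).
Local Notation H := (@halfline R).
Local Notation RM := (measurableTypeR R).
Local Notation integ A f := (mu.-integrable A (EFin \o f)).
Implicit Types (p q : R -> R) (a b c t r x y : R) (u v phi : R -> R[i]) (z w : R[i]).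

Let mH := @measurable_halfline R.

Lemma eq_parts z w : (forall P : R[i] -> R, is_part P -> P z = P w) -> z = w.
Proof.
move=> E; apply/eqP; rewrite eq_complex.
by rewrite (E _ (or_introl erefl)) (E _ (or_intror erefl)) !eqxx.
Qed.

Lemma part_dpairing_real P q phi : is_part P ->
  P (dpairing (fun r => (q r)%:C) phi) = \int[mu]_(r in H) (q r * P (phi r)).
Proof.
by case=> -> /=; apply: eq_Rintegral => r _;
  [rewrite Re_scale|rewrite Im_scale].
Qed.

Lemma part_cderive P phi r : is_part P ->
  P (cderive phi r) = derive1 (fun s => P (phi s)) r.
Proof. by move=> [->|->]. Qed.

Lemma part_dpairing_deriv_real P q phi : is_part P ->
  P (dpairing_deriv (fun r => (q r)%:C) phi) =
  - \int[mu]_(r in H) (q r * derive1 (fun s => P (phi s)) r).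
Proof.
move=> hP; rewrite /dpairing_deriv (partN hP) part_dpairing_real//.
by congr (- _); apply: eq_Rintegral => r _; rewrite part_cderive.
Qed.

Lemma ccontinuous_real p : (forall r, 0 < r -> {for r, continuous p}) ->
  forall r, 0 < r -> ccontinuous_at (fun s => (p s)%:C) r.
Proof. by move=> cp r r0; split; [exact: cp|exact: cst_continuous]. Qed.

Lemma L2_real p : sqint p -> L2 (fun r => (p r)%:C).
Proof.
move=> sp; apply/L2P; split=> //=.
by apply: (@sqint_eq _ (fun r => 0 * p r)) => [r _|]; [rewrite mul0r|exact: sqintZ].
Qed.

Section Solution.
Variables (m nu mu' lam : R) (k : int) (A1 A2 : R).
Local Notation kap := (k%:~R + lam).
Let B1 := - kap * A1 + (mu' - nu) * A2.
Let B2 := (nu + mu') * A1 + kap * A2.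
Hypothesis MB1 : - kap * B1 + (mu' - nu) * B2 = 0.
Hypothesis MB2 : (nu + mu') * B1 + kap * B2 = 0.
Local Notation p1 := (log_profile A1 B1).
Local Notation p2 := (log_profile A2 B2).

(** As M B = 0, the pair f of profiles satisfies f' = M f / r - f classically on the
    half-line, hence weakly by [C1_weak_derivative].  Reading b = - f in the
    formula for b gives the image of f under h^*. *)
Lemma solution_hstar : hstar_graph m nu mu' lam k
  (fun r => (p1 r)%:C, fun r => (p2 r)%:C)
  (fun r => (m * p1 r + p2 r)%:C, fun r => (- p1 r - m * p2 r)%:C).
Proof.
have cp1 := log_profile_continuous (A := A1) (B := B1).
have cp2 := log_profile_continuous (A := A2) (B := B2).
have s1 := log_profile_sqint A1 B1; have s2 := log_profile_sqint A2 B2.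
split=> /=.
- by move=> r r0; split; exact: ccontinuous_real.
- by split; exact: L2_real.
- split; apply: L2_real; first by apply: sqintD => //; exact: sqintZ.
  apply: (@sqint_eq _ (fun r => -1 * p1 r + (- m) * p2 r)) => [r _|].
    by rewrite mulN1r mulNr.
  by apply: sqintD; exact: sqintZ.
move=> phi tphi.
have cc q p : (fun r => (q r)%:C * (p r)%:C) = (fun r => (q r * p r)%:C :> R[i]).
  by apply/funext => r; rewrite rmorphM.
rewrite !cc.
pose dp (A B : R) r := expR (- r) * (B / r) - log_profile A B r.
have cdp A B r : 0 < r -> {for r, continuous (dp A B)}.
  move=> r0; apply: cvgB; last exact: log_profile_continuous.
  apply: cvgM.
    by apply: continuous_comp; [exact: opp_continuous|exact: continuous_expR].
  by apply: cvgMl_tmp; apply: cvgV; [rewrite gt_eqF|exact: cvg_id].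
have wd1 := C1_weak_derivative (@log_profile_derive R A1 B1) (cdp A1 B1).
have wd2 := C1_weak_derivative (@log_profile_derive R A2 B2) (cdp A2 B2).
have l1 : locint p1 by exact: sqint_locint.
have l2 : locint p2 by exact: sqint_locint.
have ld A B : locint (dp A B) by apply: continuous_locint => r; exact: cdp.
have lw p c d : locint p -> locint (fun r => (c + d / r) * p r).
  by move=> lp; apply: locintM => // r r0; exact: continuous_affine_inv.
have lw0 p d : locint p -> locint (fun r => d / r * p r).
  move=> /(lw _ 0 d); rewrite (_ : (fun r => _) = fun r => d / r * p r)//.
  by apply/funext => r; rewrite add0r.
have lD x y p q : locint p -> locint q -> locint (fun r => x * p r + y * q r).
  by move=> lp lq; apply: locintD; exact: locintZ.
split; apply: eq_parts => P hP; rewrite !(partD hP).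
- rewrite (partN hP) (part_dpairing_deriv_real _ _ hP) !(part_dpairing_real _ _ hP).
  have [sphi [a [b [a0 out]]]] := test_function_part hP tphi.
  have cphi := rsmooth_continuous sphi.
  rewrite (wd2 _ _ _ sphi a0 out).
  pose L p := \int[mu]_(r in H) (p r * P (phi r)).
  have Llin p q x y : locint p -> locint q ->
      L (fun r => x * p r + y * q r) = x * L p + y * L q.
    by move=> lp lq; exact: (pairing_linear x y cphi a0 out lp lq).
  pose a1 r := (m + (nu + mu') / r) * p1 r.
  pose b2 r := kap / r * p2 r.
  pose e r := 1 * a1 r + 1 * b2 r.
  have la1 : locint a1 by exact: lw.
  have lb2 : locint b2 by exact: lw0.
  have le : locint e by exact: lD.
  have -> : \int[mu]_(r in H) ((m * p1 r + p2 r) * P (phi r)) =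
      L (fun r => 1 * e r + (-1) * dp A2 B2 r).
    apply: eq_Rintegral => r; rewrite inE => r0; congr (_ * _).
    have rn : r != 0 by rewrite gt_eqF.
    (* The coefficient of log r / r is a component of M B. *)
    have E : expR (- r) / r * ((nu + mu') * B1 + kap * B2) * ln r = 0.
      by rewrite MB2 mulr0 mul0r.
    have E2 : expR (- r) * (B2 / r) =
       expR (- r) / r * ((nu + mu') * A1 + kap * A2) by rewrite /B2; ring.
    rewrite /e /a1 /b2 /dp E2 !mul1r mulN1r.
    apply/eqP; rewrite -subr_eq0; apply/eqP.
    rewrite -[RHS]oppr0 -E /log_profile; ring.
  rewrite (Llin e (dp A2 B2))// (Llin a1 b2)// !mul1r mulN1r opprK.
  by rewrite -/(L (dp A2 B2)) -/(L a1) -/(L b2); ring.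
- rewrite (part_dpairing_deriv_real _ _ hP) !(part_dpairing_real _ _ hP).
  have [sphi [a [b [a0 out]]]] := test_function_part hP tphi.
  have cphi := rsmooth_continuous sphi.
  rewrite (wd1 _ _ _ sphi a0 out).
  pose L p := \int[mu]_(r in H) (p r * P (phi r)).
  have Llin p q x y : locint p -> locint q ->
      L (fun r => x * p r + y * q r) = x * L p + y * L q.
    by move=> lp lq; exact: (pairing_linear x y cphi a0 out lp lq).
  pose a1 r := kap / r * p1 r.
  pose b2 r := (- m + (nu - mu') / r) * p2 r.
  pose e r := 1 * a1 r + 1 * b2 r.
  have la1 : locint a1 by exact: lw0.
  have lb2 : locint b2 by exact: lw.
  have le : locint e by exact: lD.
  have -> : \int[mu]_(r in H) ((- p1 r - m * p2 r) * P (phi r)) =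
      L (fun r => 1 * e r + 1 * dp A1 B1 r).
    apply: eq_Rintegral => r; rewrite inE => r0; congr (_ * _).
    have rn : r != 0 by rewrite gt_eqF.
    have E : expR (- r) / r * (- kap * B1 + (mu' - nu) * B2) * ln r = 0.
      by rewrite MB1 mulr0 mul0r.
    have E2 : expR (- r) * (B1 / r) =
       expR (- r) / r * (- kap * A1 + (mu' - nu) * A2) by rewrite /B1; ring.
    rewrite /e /a1 /b2 /dp E2 !mul1r.
    apply/eqP; rewrite -subr_eq0; apply/eqP.
    rewrite -E /log_profile; ring.
  rewrite (Llin e (dp A1 B1))// (Llin a1 b2)// !mul1r opprK.
  by rewrite -/(L (dp A1 B1)) -/(L a1) -/(L b2); ring.
Qed.

Lemma normc_real x : normc (x%:C : R[i]) = `|x|.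
Proof. by rewrite /= expr0n addr0 sqrtr_sqr. Qed.

(** The factor exp(- r) - 1 is at most r in absolute value. *)
Lemma log_profile_residual_le (A B : R) r : 0 < r ->
  `|log_profile A B r - (A + B * ln r)| <= r * (`|A| + `|B| * `|ln r|).
Proof.
move=> r0.
have -> : log_profile A B r - (A + B * ln r) = (expR (- r) - 1) * (A + B * ln r).
  by rewrite /log_profile; ring.
rewrite normrM; apply: ler_pM => //; last first.
  by apply: (le_trans (ler_normD _ _)); rewrite normrM.
have h1 := expR_ge1Dx (- r); have h2 : expR (- r) <= 1.
  by rewrite -expR0 ler_expR oppr_le0 ltW.
by rewrite ler_norml; apply/andP; split; lra.
Qed.

Lemma sqrt_mul_ln_le r : 0 < r ->
  Num.sqrt r * `|ln r| <=
    4 * (Num.sqrt (Num.sqrt r) ^+ 3 + Num.sqrt (Num.sqrt r)).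
Proof.
move=> r0; have [] := fourth_root r0; set w := Num.sqrt (Num.sqrt r).
move=> w0 qE rE lE.
have h1 := ln_sublinear w0.
have wV0 : 0 < w^-1 by rewrite invr_gt0.
have h2 : - ln w < w^-1 by rewrite -lnV ?posrE//; exact: ln_sublinear.
have h : `|ln w| <= w + w^-1 by rewrite ler_norml; apply/andP; split; lra.
have -> : 4 * (w ^+ 3 + w) = w ^+ 2 * (4 * (w + w^-1)).
  by field; rewrite gt_eqF.
by rewrite qE lE normrM ger0_norm// ler_wpM2l ?sqr_ge0// ler_wpM2l.
Qed.

(** By [log_profile_residual_le] the residual is O(r (1 + |log r|)), and
    sqrt r |log r| tends to 0 by [sqrt_mul_ln_le]. *)
Lemma solution_boundary (theta : R) : A1 * sin theta + A2 * cos theta = 0 ->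
  boundary_cond nu mu' lam k theta (fun r => (p1 r)%:C, fun r => (p2 r)%:C).
Proof.
move=> hA; exists A1%:C, A2%:C; split.
  by rewrite -!rmorphM -rmorphD /= hA.
pose c1 := `|A1| + `|A2|; pose c2 := `|B1| + `|B2|.
pose w r : R := Num.sqrt (Num.sqrt r).
have w_cvg : w r @[r --> 0^'+] --> (0 : R).
  have w00 : w 0 = 0 by rewrite /w !sqrtr0.
  rewrite -[X in _ --> X]w00; apply: cvg_at_right_filter.
  apply: (@continuous_comp _ _ _ (@Num.sqrt R) (@Num.sqrt R)); exact: sqrt_continuous.
apply: (@squeeze_cvgr _ _ _ _ (cst 0)
  (fun r => c1 * w r ^+ 2 + c2 * (4 * (w r ^+ 3 + w r)))); last 2 first.
- exact: cvg_cst.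
- have E : c1 * 0 ^+ 2 + c2 * (4 * (0 ^+ 3 + 0)) = 0 :> R by rewrite !expr0n /=; ring.
  rewrite -[X in _ --> X]E.
  have wX n : w r ^+ n @[r --> 0^'+] --> (0 : R) ^+ n.
    exact: (continuous_cvg _ (@exprn_continuous R n 0) w_cvg).
  apply: cvgD; apply: cvgMl_tmp; first exact: wX.
  by apply: cvgMl_tmp; apply: cvgD; [exact: wX|exact: w_cvg].
near=> r.
have r0 : 0 < r by near: r; exact: nbhs_right_gt.
have q0 : 0 < Num.sqrt r by rewrite sqrtr_gt0.
rewrite powRN (powR12_sqrt (ltW r0)) /=.
rewrite -/(residual nu mu' lam k (p1 r)%:C (p2 r)%:C A1%:C A2%:C r).
have [v1E v2E] := residual_entries nu mu' lam k (p1 r)%:C (p2 r)%:C A1%:C A2%:C r.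
set v := residual _ _ _ _ _ _ _ _ _ in v1E v2E *.
have n1 : normc (v ord0 ord0) <= r * (`|A1| + `|B1| * `|ln r|).
  have -> : v ord0 ord0 = (log_profile A1 B1 r - (A1 + B1 * ln r))%:C.
    by rewrite v1E /B1 !(rmorphD, rmorphB, rmorphM, rmorphN) /=; ring.
  by rewrite normc_real; exact: log_profile_residual_le.
have n2 : normc (v ord_max ord0) <= r * (`|A2| + `|B2| * `|ln r|).
  have -> : v ord_max ord0 = (log_profile A2 B2 r - (A2 + B2 * ln r))%:C.
    by rewrite v2E /B2 !(rmorphD, rmorphB, rmorphM, rmorphN) /=; ring.
  by rewrite normc_real; exact: log_profile_residual_le.
have nv : norm_C2 v <= normc (v ord0 ord0) + normc (v ord_max ord0).
  have h1 := normc_ge0 (v ord0 ord0); have h2 := normc_ge0 (v ord_max ord0).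
  rewrite norm_C2E -[leRHS](ger0_norm (addr_ge0 h1 h2)) -sqrtr_sqr ler_wsqrtr//.
  by rewrite sqrrD addrAC lerDl mulrn_wge0// mulr_ge0.
apply/andP; split; first by rewrite divr_ge0 ?sqrtr_ge0.
rewrite ler_pdivrMr//.
apply: (le_trans nv); apply: (le_trans (lerD n1 n2)).
have -> : r * (`|A1| + `|B1| * `|ln r|) + r * (`|A2| + `|B2| * `|ln r|) =
    (c1 * Num.sqrt r + c2 * (Num.sqrt r * `|ln r|)) * Num.sqrt r.
  rewrite -[X in X * _ + _](sqr_sqrtr (ltW r0)) -[X in _ + X * _](sqr_sqrtr (ltW r0)).
  by rewrite /c1 /c2; ring.
apply: ler_wpM2r; first exact: ltW.
have -> : w r ^+ 2 = Num.sqrt r by rewrite sqr_sqrtr ?sqrtr_ge0.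
by rewrite lerD2l ler_wpM2l ?addr_ge0// sqrt_mul_ln_le.
Unshelve. all: by end_near. Qed.

End Solution.

(** On ]0, e] the function is at least |c| exp(- 1) / e in absolute value, so its
    square has integral at least a multiple of c^2 / e, for every e in ]0, 1]. *)
Lemma exp_over_r_not_sqint c : sqint (fun r => c * expR (- r) / r) -> c = 0.
Proof.
move=> sc; have ic := sqint_integrable sc.
pose I := \int[mu]_(r in H) (c * expR (- r) / r) ^+ 2.
have I0 : 0 <= I by apply: Rintegral_ge0 => r _; exact: sqr_ge0.
have key e : 0 < e -> e <= 1 -> (c * expR (-1)) ^+ 2 <= e * I.
  move=> e0 e1.
  have mE : measurable (`]0, e]%classic : set RM) by exact: measurable_itv.
  have EH : `]0, e] `<=` H by exact: itv_oc_halfline.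
  have h1 : (\int[mu]_(r in `]0%R, e]) (((c * expR (-1)) / e) ^+ 2)%:E <= I%:E)%E.
    rewrite /I /Rintegral (fineK (integrable_fin_num mH ic)).
    apply: (@le_trans _ _ (\int[mu]_(r in `]0%R, e]) ((c * expR (- r) / r) ^+ 2)%:E)%E).
      apply: ge0_le_integral => //.
      - by move=> r _; rewrite lee_fin sqr_ge0.
      - by case/integrableP: (integ_sub mH mE EH ic).
      move=> r /=; rewrite in_itv /= => /andP[r0 re].
      rewrite lee_fin -[leLHS]real_normK ?num_real// -[leRHS]real_normK ?num_real//.
      rewrite ler_pXn2r ?nnegrE// !normrM -!mulrA ler_wpM2l//.
      rewrite !gtr0_norm ?expR_gt0 ?invr_gt0//.
      apply: ler_pM; rewrite ?expR_ge0 ?invr_ge0 ?(ltW e0)//.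
        by rewrite ler_expR lerN2 (le_trans re).
      by rewrite lef_pV2.
    apply: ge0_subset_integral => //.
    - by case/integrableP: ic.
    - by move=> r _; rewrite lee_fin sqr_ge0.
  move: h1; rewrite integral_cst//= lebesgue_measure_itv /= lte_fin e0 oppr0 adde0.
  rewrite -EFinM lee_fin => h1.
  have -> : (c * expR (-1)) ^+ 2 = e * ((c * expR (-1) / e) ^+ 2 * e).
    by field; rewrite gt_eqF.
  by rewrite ler_wpM2l// ltW.
have : (c * expR (-1)) ^+ 2 <= 0.
  apply/ler_addgt0Pr => eta eta0; rewrite add0r.
  pose e := Num.min 1 (eta / (I + 1)).
  have I1 : 0 < I + 1 by rewrite ltr_wpDl.
  have e0 : 0 < e by rewrite lt_min ltr01 divr_gt0.
  apply: (le_trans (key e e0 _)); first by rewrite ge_min lexx.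
  apply: (@le_trans _ _ (eta / (I + 1) * I)).
    by rewrite ler_wpM2r// ge_min lexx orbT.
  by rewrite mulrAC ler_pdivrMr// ler_wpM2l ?(ltW eta0)// lerDl.
rewrite le_eqVlt ltNge sqr_ge0 orbF sqrf_eq0 mulf_eq0 => /orP[/eqP//|].
by rewrite gt_eqF// expR_gt0.
Qed.

(** This is M (M A) = 0, that is, M^2 = 0. *)
Lemma critical_nilpotent (kap nu mu' A1 A2 : R) :
  kap ^+ 2 + mu' ^+ 2 - nu ^+ 2 = 0 ->
  - kap * (- kap * A1 + (mu' - nu) * A2) + (mu' - nu) * ((nu + mu') * A1 + kap * A2) = 0
  /\ (nu + mu') * (- kap * A1 + (mu' - nu) * A2) + kap * ((nu + mu') * A1 + kap * A2) = 0.
Proof.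
move=> crit; split.
  by rewrite -[RHS](mul0r A1) -crit; ring.
by rewrite -[RHS](mul0r A2) -crit; ring.
Qed.

(** This is (c M) A = 0. *)
Lemma critical_left_kernel (kap nu mu' A1 A2 c1 c2 : R) :
  c1 * kap = c2 * (nu + mu') -> c1 * (nu - mu') = c2 * kap ->
  c1 * (- kap * A1 + (mu' - nu) * A2) + c2 * ((nu + mu') * A1 + kap * A2) = 0.
Proof.
move=> e1 e2.
have -> : c1 * (- kap * A1 + (mu' - nu) * A2) + c2 * ((nu + mu') * A1 + kap * A2) =
  (c2 * (nu + mu') - c1 * kap) * A1 + (c2 * kap - c1 * (nu - mu')) * A2 by ring.
by rewrite e1 e2 !subrr !mul0r addr0.
Qed.

(** For A = (cos theta, - sin theta) the explicit solution lies in the domain of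
    t(theta), and c f = (c A) exp(- r).  Membership in J makes (c A) exp(- r) / r
    square integrable, which forces c A = 0. *)
Lemma Jspace_t_domain (m nu mu' lam : R) (k : int) (theta : R) (c1 c2 : R) :
  (k%:~R + lam) ^+ 2 + mu' ^+ 2 - nu ^+ 2 = 0 ->
  c1 * (k%:~R + lam) = c2 * (nu + mu') -> c1 * (nu - mu') = c2 * (k%:~R + lam) ->
  (forall f : (R -> R[i]) * (R -> R[i]), t_domain m nu mu' lam k theta f ->
    Jspace (fun r => c1%:C * f.1 r + c2%:C * f.2 r)) ->
  c1 * cos theta = c2 * sin theta.
Proof.
move=> crit e1 e2 hJ.
set kap := k%:~R + lam in crit e1 e2.
pose A1 := cos theta; pose A2 := - sin theta.
pose B1 := - kap * A1 + (mu' - nu) * A2; pose B2 := (nu + mu') * A1 + kap * A2.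
have [MB1 MB2] := critical_nilpotent A1 A2 crit.
pose f := (fun r => (log_profile A1 B1 r)%:C : R[i], fun r => (log_profile A2 B2 r)%:C : R[i]).
have tf : t_domain m nu mu' lam k theta f.
  eexists; split; first exact: solution_hstar MB1 MB2.
  by apply: solution_boundary; rewrite /A1 /A2; ring.
have [_ /L2P[sre _] _] := hJ f tf.
apply/eqP; rewrite -subr_eq0; apply/eqP; apply: exp_over_r_not_sqint.
apply: sqint_eq sre => r r0.
rewrite Re_divr /f /= !(mul0r, mulr0, subr0); congr (_ / _).
have cB : c1 * B1 + c2 * B2 = 0 by exact: critical_left_kernel.
rewrite /log_profile.
have -> : c1 * (expR (- r) * (A1 + B1 * ln r)) + c2 * (expR (- r) * (A2 + B2 * ln r)) =
  (c1 * A1 + c2 * A2) * expR (- r) + (c1 * B1 + c2 * B2) * ln r * expR (- r) by ring.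
by rewrite cB !mul0r addr0 /A2 mulrN.
Qed.

End Necessity.

Theorem proposition1p8 (R : realType) (m nu mu lam : R) (k : int)
  (hnumu : (nu, mu) <> (0, 0)) (hk : k <> 0)
  (hcrit : (k%:~R + lam) ^+ 2 + mu ^+ 2 - nu ^+ 2 = 0)
  (theta : R) (htheta : 0 <= theta /\ theta < pi) :
  (forall f : (R -> R[i]) * (R -> R[i]),
     t_domain m nu mu lam k theta f -> Jspace (phi_minus nu mu lam k f))
  <->
  theta = (if nu + mu != 0 then arccot ((k%:~R + lam) / (nu + mu)) else 0).
Proof.
have [th0 thpi] := htheta.
set kap := k%:~R + lam in hcrit *.
have [nm0|nmn0] := eqVneq (nu + mu) 0.
(* Here the criticality condition reduces to kap^2 = (nu - mu) (nu + mu) = 0. *)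
- have kap0 : kap = 0.
    apply/eqP; rewrite -sqrf_eq0; apply/eqP; rewrite -hcrit.
    have -> : kap ^+ 2 + mu ^+ 2 - nu ^+ 2 = kap ^+ 2 + (mu - nu) * (nu + mu) by ring.
    by rewrite nm0 mulr0 addr0.
  have nun0 : nu != 0.
    apply/eqP => nu0; apply: hnumu; rewrite nu0; congr (_, _).
    by move: nm0; rewrite nu0 add0r.
  have phiE f : phi_minus nu mu lam k f = fun r => 0%:C * f.1 r + (- 2 * nu)%:C * f.2 r.
    by apply/funext => r; rewrite /phi_minus nm0 eqxx /= mul0r add0r.
  have e1 : 0 * (k%:~R + lam) = (- 2 * nu) * (nu + mu) by rewrite nm0 mulr0 mul0r.
  have e2 : 0 * (nu - mu) = (- 2 * nu) * (k%:~R + lam) by rewrite -/kap kap0 mulr0 mul0r.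
  split=> [hJ|-> f tf].
    have := Jspace_t_domain hcrit e1 e2
      (fun f tf => eq_ind _ (@Jspace R) (hJ f tf) _ (phiE f)).
    rewrite mul0r => /esym/eqP; rewrite !mulf_eq0 oppr_eq0 pnatr_eq0 (negbTE nun0) /=.
    move=> /eqP sin0; apply/eqP; rewrite eq_le th0 andbT leNgt; apply/negP => thgt0.
    by have := @sin_gt0_pi R theta; rewrite thgt0 thpi sin0 ltxx => /(_ isT).
  rewrite phiE; apply: t_domain_Jspace tf => // Ap Am.
  by rewrite sin0 cos0 mulr0 mulr1 add0r mul0r add0r => ->; rewrite mulr0.
- have phiE f : phi_minus nu mu lam k f = fun r => (nu + mu)%:C * f.1 r + kap%:C * f.2 r.
    by apply/funext => r; rewrite /phi_minus nmn0.
  have e1 : (nu + mu) * (k%:~R + lam) = kap * (nu + mu) by rewrite mulrC.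
  have e2 : (nu + mu) * (nu - mu) = kap * (k%:~R + lam).
    by apply/eqP; rewrite -subr_eq0; apply/eqP; rewrite -[RHS]oppr0 -hcrit -/kap; ring.
  set x := kap / (nu + mu).
  split=> [hJ|thE f tf].
    have h := Jspace_t_domain hcrit e1 e2
      (fun f tf => eq_ind _ (@Jspace R) (hJ f tf) _ (phiE f)).
    have s0 : sin theta != 0.
      apply/eqP => s0; have := cos2Dsin2 theta; rewrite s0 expr0n addr0.
      move: h; rewrite s0 mulr0 => /eqP; rewrite mulf_eq0 (negbTE nmn0) /= => /eqP ->.
      by rewrite expr0n /= => /esym/eqP; rewrite oner_eq0.
    have thgt0 : 0 < theta.
      by rewrite lt_neqAle th0 andbT eq_sym; apply: contra_neq s0 => ->; rewrite sin0.
    (* The relation h says that cot theta = x. *)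
    have tanE : tan (pi / 2 - theta) = x.
      rewrite /tan -[pi / 2 - theta]opprB sinN cosN sinBpihalf opprK.
      rewrite cosBpihalf /x.
      by apply/eqP; rewrite eqr_div//; apply/eqP; rewrite mulrC h mulrC.
    rewrite /= /arccot; have := tanK (x := pi / 2 - theta); rewrite tanE => ->.
      by lra.
    by rewrite in_itv /=; apply/andP; split; lra.
  rewrite phiE; apply: t_domain_Jspace tf => // Ap Am.
  have sE : sin theta = cos (atan x).
    by rewrite thE /arccot -opprB sinN sinBpihalf opprK.
  have c0 : cos (atan x) != 0.
    by rewrite gt_eqF// cos_atan invr_gt0 sqrtr_gt0 ltr_wpDr// sqr_ge0.
  have cE : cos theta = x * cos (atan x).
    rewrite thE /arccot -opprB cosN cosBpihalf.
    by rewrite -{2}(atanK x) /tan divfK.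
  rewrite sE cE => hA.
  have nmC : (nu + mu)%:C != 0 :> R[i] by rewrite fmorph_eq0.
  have cC : (cos (atan x))%:C != 0 :> R[i] by rewrite fmorph_eq0.
  apply: (mulIf cC); rewrite mul0r -(mulr0 (nu + mu)%:C) -hA.
  have -> : kap%:C = (nu + mu)%:C * x%:C :> R[i].
    by rewrite -rmorphM /x /= mulrC divfK.
  have -> : (x * cos (atan x))%:C = x%:C * (cos (atan x))%:C :> R[i] by rewrite rmorphM.
  move: (nu + mu)%:C x%:C (cos (atan x))%:C => a b c.
  by ring.
Qed.
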